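(* The Sprott system with a single input and control vector $f$, that is $\dot x=Lx+P_2x\odot P_2x+uf$ in $\mathbb{R}^3$, is small-time locally controllable from the origin if and only if $f\notin\mathrm{Span}\{\mathbf{1}\}\cup\mathrm{Span}\{\mathbf{1}\}^{\perp}$.
   Context: Here $\mathbf{1}=(1,1,1)^T$, $\perp$ is the Euclidean orthogonal complement in $\mathbb{R}^3$, $\odot$ is the Hadamard (componentwise) product, $P_2x=(x_2,x_3,x_1)^T$, and $L=\begin{bmatrix}-\mu&0&-1\\-1&-\mu&0\\0&-1&-\mu\end{bmatrix}$ with $\mu\in\mathbb{R}$. Explicitly, the drift is $(-\mu x_1-x_3+x_2^2,\;-x_1-\mu x_2+x_3^2,\;-x_2-\mu x_3+x_1^2)^T$. The control vector field $f\in\mathbb{R}^3$ is constant and nonzero. The scalar control $u$ takes values in a bounded set $U\subset\mathbb{R}$ whose affine hull is $\mathbb{R}$. Admissible controls are Lebesgue integrable functions $u(\cdot):[0,T]\to U$, $T>0$; an admissible trajectory is an absolutely continuous curve satisfying the equation for almost all $t\in[0,T]$. $\mathcal{R}(T,p)$ is the set of $q$ for which there is an admissible trajectory with $x(0)=p$, $x(T)=q$, and $\mathcal{R}(\le T,p)=\bigcup_{0\le t\le T}\mathcal{R}(t,p)$. The system is small-time locally controllable from $p$ if $p$ is in the interior of $\mathcal{R}(\le T,p)$ for all $T>0$.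
   Formalization: The formal theorem also assumes that 0 is an interior point of the convex hull of the control set U; otherwise the ''if'' direction fails, e.g. for U={1,2} and f=(1,0,0)^T, where no point with x_1<0 is reachable in small time. *)

(* Defs.v *)
From HB Require Import structures.
From mathcomp Require Export all_boot all_order all_algebra.
From mathcomp Require Export all_classical all_reals all_analysis.
Export numFieldNormedType.Exports.
Export Order.TTheory GRing.Theory Num.Theory.

Set Implicit Arguments.
Unset Strict Implicit.
Unset Printing Implicit Defensive.

Local Open Scope classical_set_scope.
Local Open Scope ring_scope.

Definition affine_hull (R : realType) (A : set R) : set R :=
  [set x | exists n (c v : 'I_n -> R),
     [/\ forall i, A (v i), \sum_i c i = 1 & x = \sum_i c i * v i]].

Definition convex_hull (R : realType) (A : set R) : set R :=
  [set x | exists n (c v : 'I_n -> R),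
     [/\ forall i, 0 <= c i, forall i, A (v i), \sum_i c i = 1
       & x = \sum_i c i * v i]].

Definition absolutely_continuous (R : realType) (V : normedModType R)
    (a b : R) (x : R -> V) : Prop :=
  forall e : R, 0 < e -> exists2 d : R, 0 < d &
    forall n (s t : 'I_n -> R),
      (forall i, a <= s i /\ s i <= t i /\ t i <= b) ->
      trivIset setT (fun i => `]s i, t i[%classic) ->
      \sum_i (t i - s i) < d -> \sum_i `|x (t i) - x (s i)| < e.

Section ControlSystem.
Context {R : realType} {V : normedModType R}.
Variables (F : V -> V) (f : V) (U : set R).

(* Controls and curves are total functions on R; only their restrictions to
   [0, T] matter. *)
Definition admissible_control (T : R) (u : R -> R) : Prop :=
  lebesgue_measure.-integrable `[0, T] (EFin \o u) /\
  forall t, t \in `[0, T] -> U (u t).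

(* The two-sided derivative is harmless: the endpoints form a null set. *)
Definition admissible_trajectory (T : R) (u : R -> R) (x : R -> V) : Prop :=
  absolutely_continuous 0 T x /\
  {ae lebesgue_measure, forall t : R, t \in `[0, T] ->
     is_derive t 1 x (F (x t) + u t *: f)}.

(* For T = 0 the set is {p} as soon as U is nonempty. *)
Definition reachable (T : R) (p : V) : set V :=
  [set q | exists u x, [/\ admissible_control T u,
     admissible_trajectory T u x, x 0 = p & x T = q]].

Definition reachable_upto (T : R) (p : V) : set V :=
  \bigcup_(t in `[0, T]) reachable t p.

Definition stlc (p : V) : Prop :=
  forall T : R, 0 < T -> (reachable_upto T p)° p.

End ControlSystem.

Section Sprott.
Context {R : realType}.

Definition dotv (x y : 'cV[R]_3) : R := \sum_i x i 0 * y i 0.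

Definition orthogonal_complement (A : set 'cV[R]_3) : set 'cV[R]_3 :=
  [set x | forall a, A a -> dotv a x = 0].

Definition hadamard (x y : 'cV[R]_3) : 'cV[R]_3 := map2_mx *%R x y.

(* ordS is the cyclic successor on {0, 1, 2}. *)
Definition P2 (x : 'cV[R]_3) : 'cV[R]_3 := \col_i x (ordS i) 0.

Definition sprott_mx (mu : R) : 'M[R]_3 :=
  \matrix_(i, j) nth 0 (nth [::] [:: [:: - mu;   0; - 1];
                                     [:: - 1; - mu;   0];
                                     [::   0; - 1; - mu]] i) j.

Definition sprott_drift (mu : R) (x : 'cV[R]_3) : 'cV[R]_3 :=
  sprott_mx mu *m x + hadamard (P2 x) (P2 x).

Definition ones : 'cV[R]_3 := const_mx 1.

Definition span_ones : set 'cV[R]_3 := [set` <[ones]>%VS].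

End Sprott.

(* Main.v *)
Require Import Defs.
From HB Require Import structures.
From mathcomp Require Import ring lra measurable_realfun.

Set Implicit Arguments.
Unset Strict Implicit.
Unset Printing Implicit Defensive.

Local Open Scope classical_set_scope.
Local Open Scope ring_scope.

(** The two excluded positions of [f] each leave an obstruction. If [f] is a
multiple of [ones], the diagonal is invariant and all trajectories from the
origin stay on it ([coord_eq]). If [f] is orthogonal to [ones], the coordinate
sum [s] satisfies [s' = - (mu + 1) s + |x|^2], so it can never become negative
([sum_coord_ge0]). Both arguments need that an absolutely continuous function
whose derivative is almost everywhere nonnegative does not decrease
([ac_nondecreasing]).

In all other cases [f] and its two cyclic shifts form a basis, because their
determinant is the coordinate sum of [f] times a quadratic form that vanishes
only on the diagonal ([circulant_det_neq0]). Hence the linear part of the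
system is controllable; [sprott_linear_steering] gives explicit polynomial
curves and controls to every target. It remains to pass to the nonlinear system
and to controls in [U], which need not be convex; since 0 is interior to the
convex hull of [U], the set [U] has elements [a < 0 < b], and only these two
values are used.

Substituting [x = y + W f], with [W] a primitive of the control, turns the
system into an ordinary differential equation in which the control appears only
through the continuous function [W]. So [W] matters only up to a uniformly
small error, and any [W] with slopes between [a] and [b] may be replaced by a
[sawtooth] with slopes [a] and [b]. The endpoint is then prescribed by a
contraction: the remainder of the trajectory, after the linear steering and the
sawtooth error are subtracted, determines the endpoint error, the endpoint
error determines the target of the linear steering, and this determines the
remainder again ([steering_correction]). The map contracts in the sup norm
because the time is short, the nonlinear part of the drift has a small
Lipschitz constant near the origin, and so does the sawtooth error as a
function of the target ([sawtooth_contraction]). A fixed point exists for each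
target close to the origin ([linear_test]). *)

(** * Absolute continuity and monotonicity *)

Lemma derive_ge0_locally (R : realType) (g : R -> R) (c d e : R) :
  0 <= d -> 0 < e -> is_derive c 1 g d ->
  exists2 eta : R, 0 < eta & forall t, `|t - c| < eta ->
    (t <= c -> - e * (c - t) <= g c - g t) /\
    (c <= t -> - e * (t - c) <= g t - g c).
Proof.
move=> d0 e0 gd.
have : (fun h : R => h^-1 *: (g (h *: 1 + c) - g c)) @ 0^' --> d.
  have [+ <-] := gd; rewrite /derivable /derive => /cvg_ex[l lP].
  by rewrite (cvg_lim _ lP).
move/cvgrPdist_lt => /(_ _ e0)[/= r r0 H].
exists r => // t tc.
have [->|tNc] := eqVneq t c; first by rewrite !subrr mulr0.
have tc0 : t - c != 0 by rewrite subr_eq0.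
have := H (t - c); rewrite /= sub0r normrN => /(_ tc tc0).
rewrite /GRing.scale /= mulr1 subrK => /ltr_normlP[_ K].
have {}K : - e < (t - c)^-1 * (g t - g c) by lra.
split=> ht.
  have tc_lt : t - c < 0 by rewrite subr_lt0 lt_neqAle tNc.
  have := ltr_nM2r tc_lt ((t - c)^-1 * (g t - g c)) (- e).
  rewrite K mulrAC mulVf// mul1r; lra.
have tc_gt : 0 < t - c by rewrite subr_gt0 lt_neqAle eq_sym tNc.
have := ltr_pM2r tc_gt (- e) ((t - c)^-1 * (g t - g c)).
rewrite K mulrAC mulVf// mul1r; lra.
Qed.

Section ac_monotone.
Context {R : realType}.
Variables (T e : R) (g : R -> R) (O : set R).

(** Chains of steps from 0 to [t]: at the cost [e] per unit of time the
function loses no more than its variation over finitely many disjoint intervals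
of [O]. Recording the intervals themselves, rather than the supremum of the
variation, is what lets absolute continuity be applied once, at the end. *)
Definition ac_chain (t : R) : Prop := exists n (s u : 'I_n -> R),
  [/\ forall i, [/\ 0 <= s i, s i <= u i & u i <= t],
      trivIset setT (fun i => `]s i, u i[%classic),
      forall i, `]s i, u i[ `<=` O
    & g 0 - e * t - \sum_i `|g (u i) - g (s i)| <= g t].

Lemma ac_chain0 : ac_chain 0.
Proof.
exists 0%N, (fun=> 0), (fun=> 0); split=> [[]//|||].
- by move=> [].
- by move=> [].
- by rewrite big_ord0 mulr0 !subr0.
Qed.

Lemma ac_chain_slope (t t' : R) : t <= t' -> - e * (t' - t) <= g t' - g t ->
  ac_chain t -> ac_chain t'.
Proof.
move=> tt' gtt' [n [s [u [H1 H2 H3 H4]]]]; exists n, s, u; split => //.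
- by move=> i; have [? ? ?] := H1 i; split=> //; lra.
- lra.
Qed.

Lemma ac_chain_jump (t t' : R) : 0 <= e -> 0 <= t -> t <= t' ->
  `]t, t'[ `<=` O -> ac_chain t -> ac_chain t'.
Proof.
move=> e0 t0 tt' tO [n [s [u [H1 H2 H3 H4]]]].
pose s' (i : 'I_n.+1) := if unlift ord0 i is Some j then s j else t.
pose u' (i : 'I_n.+1) := if unlift ord0 i is Some j then u j else t'.
have disj j x : `]s j, u j[%classic x -> `]t, t'[%classic x -> False.
  have [_ _ ut] := H1 j.
  by rewrite /= !in_itv/= => /andP[_ xu] /andP[tx _]; lra.
exists n.+1, s', u'; split.
- move=> i; rewrite /s' /u'; case: unliftP => [j _|_] //.
  by have [? ? ?] := H1 j; split=> //; lra.
- move=> i j _ _; rewrite /s' /u'.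
  case: unliftP => [i' ->|->]; case: unliftP => [j' ->|->] //= [x [xi xj]].
  + by congr (lift _ _); apply: H2 => //; exists x.
  + by have := disj _ _ xi xj.
  + by have := disj _ _ xj xi.
- by move=> i; rewrite /s' /u'; case: unliftP.
- rewrite big_ord_recl /s' /u' unlift_none.
  under eq_bigr do rewrite liftK.
  have := ler_norm (g t - g t'); rewrite distrC.
  have : e * t <= e * t' by rewrite ler_wpM2l.
  lra.
Qed.

(** A real induction. A chain can be extended across every point: by a slope
estimate where the derivative is nonnegative, by a single interval where the
point lies in [O]; so the supremum of the reachable times is [T]. *)
Lemma ac_chain_end :
  0 <= T -> 0 < e -> open O ->
  (forall t, t \in `[0, T] -> ~ O t -> exists2 d, 0 <= d & is_derive t 1 g d) ->
  ac_chain T.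
Proof.
move=> T0 e0 oO gd.
have loc c : c \in `[0, T] -> exists2 eta : R, 0 < eta &
    forall t, t \in `[0, T] -> `|t - c| < eta ->
    (t <= c -> ac_chain t -> ac_chain c) /\ (c <= t -> ac_chain c -> ac_chain t).
  move=> cT; have [Oc|nOc] := pselect (O c).
    have /nbhs_ballP[eta /= eta0 ceta] := open_nbhs_nbhs (conj oO Oc).
    exists eta => // t tT tc; split=> le; apply: ac_chain_jump => //.
    - exact: ltW.
    - by move: tT; rewrite in_itv/= => /andP[].
    - move=> x; rewrite /= in_itv/= => /andP[x1 x2]; apply: ceta.
      by move: tc; rewrite /ball/= !ltr_norml => /andP[? ?]; lra.
    - exact: ltW.
    - by move: cT; rewrite in_itv/= => /andP[].
    - move=> x; rewrite /= in_itv/= => /andP[x1 x2]; apply: ceta.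
      by move: tc; rewrite /ball/= !ltr_norml => /andP[? ?]; lra.
  have [d d0 dP] := gd _ cT nOc.
  have [eta eta0 H] := derive_ge0_locally d0 e0 dP.
  exists eta => // t _ tc; have [H1 H2] := H _ tc.
  by split=> le; apply: ac_chain_slope => //; auto.
pose S := [set t | t \in `[0, T] /\ ac_chain t].
have S0 : S 0 by split; [rewrite in_itv/= lexx|exact: ac_chain0].
have ubS : ubound S T by move=> t [+ _]; rewrite in_itv/= => /andP[].
have hsS : has_sup S by split; [exists 0|exists T].
have cT : sup S \in `[0, T].
  by rewrite in_itv/= sup_upper_bound//= sup_le_ub//; exists 0.
have [eta eta0 H] := loc _ cT.
have [t [tT tS] ct] := sup_adherent eta0 hsS.
have tc : t <= sup S by apply: sup_upper_bound.
have Pc : ac_chain (sup S).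
  by apply: (H t tT _).1 => //; rewrite ltr_norml; lra.
have [cTlt|] := ltP (sup S) T; last first.
  by move: cT; rewrite in_itv/= => /andP[_ h1 h2]; rewrite (_ : T = sup S)//; lra.
exfalso.
pose t' := Num.min T (sup S + eta / 2).
have ct' : sup S < t' by rewrite lt_min cTlt/=; lra.
have t'T : t' <= T by rewrite ge_min lexx.
have t'e : t' <= sup S + eta / 2 by rewrite ge_min lexx orbT.
have St' : S t'.
  have t'I : t' \in `[0, T].
    by move: cT; rewrite !in_itv/= => /andP[? ?]; lra.
  by split=> //; apply: (H t' t'I _).2 => //; [rewrite ltr_norml; lra|lra].
have := sup_upper_bound hsS St'.
by rewrite leNgt ct'.
Qed.

End ac_monotone.

(** Outer regularity of the Lebesgue measure, in the form needed to hide an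
exceptional null set inside an open set of small measure. *)
Lemma ae_open_cover (R : realType) (P : R -> Prop) (d : R) : 0 < d ->
  {ae lebesgue_measure, forall t : R, P t} ->
  exists O : set R, [/\ open O, (lebesgue_measure O < d%:E)%E
    & forall t, ~ O t -> P t].
Proof.
move=> d0 [N [mN N_null NS]].
have [|O [oO NO muO]] := lebesgue_regularity_outer mN _ d0.
  by rewrite [X in (X < _)%E](_ : _ = 0%E) ?ltry//; exact: N_null.
exists O; split => //.
- have mO : measurable O by exact: measurable_realfun.open_measurable.
  apply: le_lt_trans muO; rewrite -[in leLHS](setDUK NO).
  apply: (le_trans (measureU2 _ _ _)) => //; first exact: measurableD.
  by rewrite [X in (X + _)%E](_ : _ = 0%E) ?add0e//; exact: N_null.
- by move=> t nOt; apply: contrapT => h; apply: nOt; apply: NO; apply: NS.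
Qed.

(** The exceptional null set is covered by an open set so small that, by
absolute continuity, a chain loses at most [e] on it; elsewhere it loses at
most [e * T]. *)
Lemma ac_nondecreasing (R : realType) (T : R) (g : R -> R) :
  0 <= T -> absolutely_continuous 0 T g ->
  {ae lebesgue_measure, forall t : R, t \in `[0, T] ->
     exists2 d : R, 0 <= d & is_derive t 1 g d} ->
  g 0 <= g T.
Proof.
move=> T0 ac aeg.
suff key e : 0 < e -> g 0 - e * T - e <= g T.
  rewrite leNgt; apply/negP => gT.
  have T1 : 0 < T + 1 by lra.
  have e0 : 0 < (g 0 - g T) / 2 / (T + 1) by rewrite !divr_gt0//; lra.
  have := key _ e0; set e := _ / (T + 1).
  have : e * (T + 1) = (g 0 - g T) / 2 by rewrite divfK// gt_eqF.
  lra.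
move=> e0; have [d d0 acd] := ac e e0.
have [ O [oO muO gO]] := ae_open_cover d0 aeg.
have [|n [s [u [H1 H2 H3 H4]]]] := @ac_chain_end R T e g O T0 e0 oO.
  by move=> t tT nOt; exact: gO.
have lt_d : \sum_i (u i - s i) < d.
  rewrite -lte_fin; apply: le_lt_trans muO.
  have -> : (\sum_i (u i - s i))%:E =
      (\sum_i lebesgue_measure (`]s i, u i[%classic : set R))%E.
    rewrite -sumEFin; apply: eq_bigr => i _.
    have [_ + _] := H1 i; rewrite lebesgue_measure_itv/= lte_fin le_eqVlt.
    by case: ltP => //= + /orP[/eqP->|]; rewrite ?subrr// leNgt => /negPf->.
  rewrite -measure_bigsetU_ord//; apply: le_measure; rewrite ?inE//.
  - exact: bigsetU_measurable.
  - exact: measurable_realfun.open_measurable.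
  - by apply: (big_ind (fun A => A `<=` O)) => // A B AO BO x [/AO|/BO].
have : \sum_i `|g (u i) - g (s i)| < e.
  apply: acd => // i; have [? ? ?] := H1 i; split; [|split] => //.
lra.
Qed.

(** * Operations on absolutely continuous functions *)

Lemma ler_coord_norm (R : realType) (m n : nat) (A : 'M[R]_(m, n)) i j :
  `|A i j| <= `|A|.
Proof. by rewrite [leRHS]/Num.norm/= mx_normrE (le_bigmax _ _ (i, j)). Qed.

Lemma is_derive_coord (R : realType) (m n : nat) (x : R -> 'M[R]_(m, n)) (t : R)
    (dx : 'M[R]_(m, n)) i j :
  is_derive t 1 x dx -> is_derive t 1 (fun s => x s i j) (dx i j).
Proof.
move=> [xt <-]; rewrite derive_mx// mxE; split=> //.
exact: (derivable_mxP _ _ _).1.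
Qed.

Section ac_closure.
Context {R : realType}.
Variables (a b : R).
Implicit Types g h : R -> R.

Lemma ac_lipschitz (V : normedModType R) (x : R -> V) (k : R) :
  (forall s t, s \in `[a, b] -> t \in `[a, b] -> s <= t ->
    `|x t - x s| <= k * (t - s)) ->
  absolutely_continuous a b x.
Proof.
move=> xk e e0.
have k1 : 0 < Num.max k 0 + 1 by rewrite ltr_wpDl// le_max lexx orbT.
exists (e / (Num.max k 0 + 1)) => [|n s t st _ lt_d]; first exact: divr_gt0.
apply: (@le_lt_trans _ _ (\sum_i (Num.max k 0 + 1) * (t i - s i))).
  apply: ler_sum => i _; have [asi [sti tib]] := st i.
  apply: (le_trans (xk _ _ _ _ sti)); rewrite ?in_itv/=; [lra|lra|].
  apply: ler_wpM2r; first lra.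
  by rewrite ler_wpDr// le_max lexx.
by rewrite -mulr_sumr mulrC -ltr_pdivlMr.
Qed.

Lemma ac_coord (m n : nat) (x : R -> 'M[R]_(m, n)) i j :
  absolutely_continuous a b x ->
  absolutely_continuous a b (fun t => x t i j).
Proof.
move=> acx e e0; have [d d0 dP] := acx e e0.
exists d => // k s t st tr lt_d; apply: le_lt_trans (dP _ s t st tr lt_d).
by apply: ler_sum => l _; have := ler_coord_norm (x (t l) - x (s l)) i j;
  rewrite !mxE.
Qed.

Lemma acD (V : normedModType R) (x y : R -> V) :
  absolutely_continuous a b x -> absolutely_continuous a b y ->
  absolutely_continuous a b (x \+ y).
Proof.
move=> acx acy e e0; have e20 : 0 < e / 2 by rewrite divr_gt0.
have [d1 d10 d1P] := acx _ e20; have [d2 d20 d2P] := acy _ e20.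
exists (Num.min d1 d2); first by rewrite lt_min d10.
move=> n s t st tr; rewrite lt_min => /andP[lt1 lt2].
rewrite (splitr e).
apply: le_lt_trans (ltrD (d1P _ s t st tr lt1) (d2P _ s t st tr lt2)).
rewrite -big_split/=; apply: ler_sum => l _.
by rewrite opprD addrACA ler_normD.
Qed.

Lemma acN (V : normedModType R) (x : R -> V) :
  absolutely_continuous a b x -> absolutely_continuous a b (\- x).
Proof.
move=> acx e e0; have [d d0 dP] := acx e e0; exists d => // n s t st tr lt_d.
apply: le_lt_trans (dP _ s t st tr lt_d); apply: ler_sum => i _ /=.
by rewrite -opprD normrN.
Qed.

Lemma ac_bounded g : a <= b -> absolutely_continuous a b g ->
  exists2 M : R, 0 < M & forall t, t \in `[a, b] -> `|g t| <= M.
Proof.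
move=> ab acg.
have cg : {within `[a, b], continuous g}.
  apply/subspace_continuousP => x xab; apply/cvgrPdist_lt => e e0.
  have [d d0 dP] := acg e e0.
  (* A single interval is a disjoint family, so continuity is the case n = 1. *)
  have H s t : s \in `[a, b] -> t \in `[a, b] -> s <= t -> t - s < d ->
      `|g t - g s| < e.
    rewrite !in_itv/= => /andP[? ?] /andP[? ?] st tsd.
    have := dP 1%N (fun=> s) (fun=> t); rewrite !big_ord1; apply => //.
    by move=> i j _ _ _; rewrite !ord1.
  near=> t.
  have tab : t \in `[a, b] by near: t; apply: withinT.
  have : `|x - t| < d.
    by near: t; apply: filterS (nbhsx_ballx x _ d0).
  by case: (leP x t) => xt; rewrite ltr_norml => /andP[? ?];
    [rewrite distrC|]; apply: H => //; lra.
have cg' : {within `[a, b], continuous (fun t => `|g t|)}.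
  by move=> x; apply: cvg_norm; apply: cg.
have [c _ cP] := EVT_max ab cg'.
by exists (`|g c| + 1) => [|t /cP]; [rewrite ltr_wpDl|lra].
Unshelve. all: by end_near. Qed.

Lemma acM g h : a <= b ->
  absolutely_continuous a b g -> absolutely_continuous a b h ->
  absolutely_continuous a b (g \* h).
Proof.
move=> ab acg ach.
have [M M0 gM] := ac_bounded ab acg; have [N N0 hN] := ac_bounded ab ach.
move=> e e0.
have e1 : 0 < e / 2 / N by rewrite !divr_gt0.
have e2 : 0 < e / 2 / M by rewrite !divr_gt0.
have [d1 d10 d1P] := acg _ e1; have [d2 d20 d2P] := ach _ e2.
exists (Num.min d1 d2); first by rewrite lt_min d10.
move=> n s t st tr; rewrite lt_min => /andP[lt1 lt2].
apply: (@le_lt_trans _ _ (\sum_i (N * `|g (t i) - g (s i)| +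
                                  M * `|h (t i) - h (s i)|))).
  apply: ler_sum => i _; have [asi [sti tib]] := st i.
  have -> : g (t i) * h (t i) - g (s i) * h (s i) =
    h (t i) * (g (t i) - g (s i)) + g (s i) * (h (t i) - h (s i)) by ring.
  apply: (le_trans (ler_normD _ _)); rewrite !normrM lerD// ler_wpM2r//.
    by apply: hN; rewrite in_itv/=; lra.
  by apply: gM; rewrite in_itv/=; lra.
rewrite big_split/= -!mulr_sumr (splitr e); apply: ltrD.
  by rewrite mulrC -ltr_pdivlMr//; apply: d1P.
by rewrite mulrC -ltr_pdivlMr//; apply: d2P.
Qed.

Lemma is_derive_expR_lin (k t : R) :
  is_derive t 1 (fun t : R => expR (k * t)) (k * expR (k * t)).
Proof.
have := @is_derive1_comp R expR (fun t : R => k * t) t _ _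
  (is_derive_expR (k * t)) _.
move=> /(_ k); rewrite /comp mulrC; apply.
by apply: is_derive_eq; rewrite /GRing.scale /= mulr1.
Qed.

Lemma ac_expR (k : R) : absolutely_continuous a b (fun t => expR (k * t)).
Proof.
have dE := is_derive_expR_lin k.
have cE (t : R) : {for t, continuous (fun t : R => expR (k * t))}.
  apply: differentiable_continuous; apply/derivable1_diffP.
  by have [] := dE t.
pose M := expR (`|k| * (`|a| + `|b|)).
apply: (@ac_lipschitz _ _ (`|k| * M)) => s t; rewrite !in_itv/=.
move=> /andP[as_ sb] /andP[at_ tb] st.
have dE' x : x \in `]s, t[ -> is_derive x 1 (fun t : R => expR (k * t))
    (k * expR (k * x)) by move=> _; exact: dE.
have cE' : {within `[s, t], continuous (fun t : R => expR (k * t))}.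
  exact: continuous_subspaceT.
have [c cst ->] := MVT_segment st dE' cE'.
- rewrite normrM (ger0_norm (_ : 0 <= t - s)) ?subr_ge0// ler_wpM2r ?subr_ge0//.
  rewrite normrM ler_wpM2l// ger0_norm ?expR_ge0// ler_expR.
  apply: (le_trans (ler_norm _)); rewrite normrM ler_wpM2l//.
  move: cst; rewrite in_itv/= => /andP[? ?].
  have := ler_norm a; have := ler_norm b.
  have := ler_norm (- a); have := ler_norm (- b); rewrite !normrN.
  by move=> *; rewrite ler_norml; lra.
Qed.

End ac_closure.

(** * Necessity of the condition on the control vector *)

Definition i0 : 'I_3 := @Ordinal 3 0 isT.
Definition i1 : 'I_3 := @Ordinal 3 1 isT.
Definition i2 : 'I_3 := @Ordinal 3 2 isT.

Lemma sum3 (V : nmodType) (F : 'I_3 -> V) : \sum_i F i = F i0 + F i1 + F i2.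
Proof.
rewrite !big_ord_recr big_ord0 /= add0r.
by congr (F _ + F _ + F _); apply: val_inj.
Qed.

Lemma forall3 (P : 'I_3 -> Prop) : P i0 -> P i1 -> P i2 -> forall i, P i.
Proof.
move=> P0 P1 P2 [[|[|[|//]]] h].
- by rewrite (_ : Ordinal h = i0)//; apply: val_inj.
- by rewrite (_ : Ordinal h = i1)//; apply: val_inj.
- by rewrite (_ : Ordinal h = i2)//; apply: val_inj.
Qed.

Section sprott_coord.
Context {R : realType}.
Variables (mu : R) (x : 'cV[R]_3).

Lemma sprott_drift0 :
  sprott_drift mu x i0 0 = - mu * x i0 0 - x i2 0 + x i1 0 ^+ 2.
Proof.
rewrite /sprott_drift !mxE sum3 !mxE /= (_ : ordS i0 = i1) ?expr2; first by ring.
exact: val_inj.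
Qed.

Lemma sprott_drift1 :
  sprott_drift mu x i1 0 = - mu * x i1 0 - x i0 0 + x i2 0 ^+ 2.
Proof.
rewrite /sprott_drift !mxE sum3 !mxE /= (_ : ordS i1 = i2) ?expr2; first by ring.
exact: val_inj.
Qed.

Lemma sprott_drift2 :
  sprott_drift mu x i2 0 = - mu * x i2 0 - x i1 0 + x i0 0 ^+ 2.
Proof.
rewrite /sprott_drift !mxE sum3 !mxE /= (_ : ordS i2 = i0) ?expr2; first by ring.
exact: val_inj.
Qed.

Lemma velocity0 (v : R) (f : 'cV[R]_3) : (sprott_drift mu x + v *: f) i0 0 =
  - mu * x i0 0 - x i2 0 + x i1 0 ^+ 2 + v * f i0 0.
Proof. by rewrite mxE sprott_drift0 mxE. Qed.

Lemma velocity1 (v : R) (f : 'cV[R]_3) : (sprott_drift mu x + v *: f) i1 0 =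
  - mu * x i1 0 - x i0 0 + x i2 0 ^+ 2 + v * f i1 0.
Proof. by rewrite mxE sprott_drift1 mxE. Qed.

Lemma velocity2 (v : R) (f : 'cV[R]_3) : (sprott_drift mu x + v *: f) i2 0 =
  - mu * x i2 0 - x i1 0 + x i0 0 ^+ 2 + v * f i2 0.
Proof. by rewrite mxE sprott_drift2 mxE. Qed.

End sprott_coord.

Section necessity.
Context {R : realType}.
Variables (mu : R) (f : 'cV[R]_3) (T : R) (u : R -> R) (x : R -> 'cV[R]_3).
Hypotheses (T0 : 0 <= T) (x0 : x 0 = 0).
Hypothesis (trx : admissible_trajectory (sprott_drift mu) f T u x).

Let acx i : absolutely_continuous 0 T (fun t => x t i 0).
Proof. exact/ac_coord/trx.1. Qed.

(** The drift increases the coordinate sum except for the linear term, because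
its quadratic part sums to the squared norm; when [f] is orthogonal to [ones]
the control does not act on the sum at all. The exponential factor absorbs the
linear term. *)
Lemma sum_coord_ge0 : dotv f ones = 0 ->
  0 <= x T i0 0 + x T i1 0 + x T i2 0.
Proof.
rewrite /dotv sum3 !mxE !mulr1 => f0.
pose k := mu + 1.
pose g := (fun t => expR (k * t)) \*
          ((fun t => x t i0 0) \+ (fun t => x t i1 0) \+ (fun t => x t i2 0)).
have acg : absolutely_continuous 0 T g.
  by apply: acM => //; [exact: ac_expR|apply: acD => //; exact: acD].
have : g 0 <= g T.
  apply: ac_nondecreasing => //; have := trx.2; apply: filterS.
    exact: (ae_filter_ringOfSetsType lebesgue_measure).
  move=> t xt tT.
  have {}xt := xt tT.
  have d0 := is_derive_coord i0 0 xt.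
  have d1 := is_derive_coord i1 0 xt.
  have d2 := is_derive_coord i2 0 xt.
  have de := is_derive_expR_lin k t.
  exists (expR (k * t) * (x t i0 0 ^+ 2 + x t i1 0 ^+ 2 + x t i2 0 ^+ 2)).
    by rewrite mulr_ge0 ?expR_ge0// !addr_ge0// sqr_ge0.
  apply: is_derive_eq; rewrite /GRing.scale/= velocity0 velocity1 velocity2.
  have -> : f i2 0 = - f i0 0 - f i1 0 by lra.
  rewrite /k; ring.
rewrite /g /= x0 !mxE !addr0 mulr0.
by rewrite pmulr_rge0// expR_gt0.
Qed.

(** The diagonal is invariant under the drift, and a control along [ones] does
not leave it. Uniqueness is obtained from a Gronwall argument: on a bounded
trajectory the derivative of the sum of the squared coordinate differences is
at most a constant multiple of that sum, which starts at zero. *)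
Lemma coord_eq (l : R) : f = l *: ones -> x T i0 0 = x T i1 0.
Proof.
move=> fE.
have [M M0 xM] : exists2 M : R, 0 < M &
    forall t, t \in `[0, T] -> forall i, `|x t i 0| <= M.
  have [M0 M00 xM0] := ac_bounded T0 (acx i0).
  have [M1 M10 xM1] := ac_bounded T0 (acx i1).
  have [M2 M20 xM2] := ac_bounded T0 (acx i2).
  exists (M0 + M1 + M2) => [|t tT]; first by rewrite !addr_gt0.
  by apply: forall3; [have := xM0 _ tT|have := xM1 _ tT|have := xM2 _ tT]; lra.
pose k : R := 2 * (`|mu| + 1 + 2 * M).
pose sq i j := (fun t => x t i 0 - x t j 0) \* (fun t => x t i 0 - x t j 0).
pose D := sq i0 i1 \+ sq i1 i2 \+ sq i2 i0.
pose g := (fun t => expR (- k * t)) \* (\- D).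
have acsq i j : absolutely_continuous 0 T (sq i j).
  have acd : absolutely_continuous 0 T (fun t => x t i 0 - x t j 0).
    by apply: acD; [exact: acx|apply: acN; exact: acx].
  exact: acM.
have acg : absolutely_continuous 0 T g.
  apply: acM => //; first exact: ac_expR.
  by apply/acN/acD => //; exact: acD.
have : g 0 <= g T.
  apply: ac_nondecreasing => //; have := trx.2; apply: filterS.
    exact: (ae_filter_ringOfSetsType lebesgue_measure).
  move=> t xt tT.
  have {}xt := xt tT.
  have d0 := is_derive_coord i0 0 xt.
  have d1 := is_derive_coord i1 0 xt.
  have d2 := is_derive_coord i2 0 xt.
  have de := is_derive_expR_lin (- k) t.
  have dsq i j vi vj : is_derive t 1 (fun t => x t i 0) vi ->
      is_derive t 1 (fun t => x t j 0) vj ->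
      is_derive t 1 (sq i j) (2 * (x t i 0 - x t j 0) * (vi - vj)).
    move=> di dj; apply: is_derive_eq.
    by rewrite /GRing.scale/=; ring.
  have dD := is_deriveD (is_deriveD (dsq _ _ _ _ d0 d1) (dsq _ _ _ _ d1 d2))
    (dsq _ _ _ _ d2 d0).
  have {dD} := is_deriveM de (is_deriveN dD).
  rewrite /GRing.scale/= velocity0 velocity1 velocity2 fE !mxE.
  set dg := (X in is_derive _ _ _ X) => gdg.
  exists dg => //; move: (xM _ tT i0) (xM _ tT i1) (xM _ tT i2).
  rewrite /dg /D /sq ?fctE /=.
  set y0 := x t i0 0; set y1 := x t i1 0; set y2 := x t i2 0.
  rewrite !ler_norml => /andP[b0 b0'] /andP[b1 b1'] /andP[b2 b2'].
  (* The difference of the two sides is a sum of two squares with nonnegative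
     weights; each quadratic term of the drift contributes one cross product. *)
  have cross p a b : - (2 * M) <= p -> p <= 2 * M ->
      2 * p * a * b <= 2 * M * (a ^+ 2 + b ^+ 2).
    move=> p1 p2; have : 0 <= (M + p / 2) * (a - b) ^+ 2 +
      (M - p / 2) * (a + b) ^+ 2.
      by rewrite addr_ge0// mulr_ge0 ?sqr_ge0//; lra.
    by lra.
  pose a := y0 - y1; pose b := y1 - y2; pose c := y2 - y0.
  have h1 : - (2 * M) <= y1 + y2 <= 2 * M by lra.
  have h2 : - (2 * M) <= y2 + y0 <= 2 * M by lra.
  have h3 : - (2 * M) <= y0 + y1 <= 2 * M by lra.
  have /andP[h1a h1b] := h1; have /andP[h2a h2b] := h2.
  have /andP[h3a h3b] := h3.
  have ab := cross _ a b h1a h1b; have bc := cross _ b c h2a h2b.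
  have ca := cross _ c a h3a h3b.
  have smu : - mu * (a ^+ 2 + b ^+ 2 + c ^+ 2) <=
      `|mu| * (a ^+ 2 + b ^+ 2 + c ^+ 2).
    apply: ler_wpM2r; first by rewrite !addr_ge0 ?sqr_ge0.
    by have := ler_norm (- mu); rewrite normrN.
  have sab : 0 <= (a + b) ^+ 2 by exact: sqr_ge0.
  have sbc : 0 <= (b + c) ^+ 2 by exact: sqr_ge0.
  have sca : 0 <= (c + a) ^+ 2 by exact: sqr_ge0.
  have := expR_ge0 (- k * t); set E := expR _ => E0.
  pose rest := k * (a ^+ 2 + b ^+ 2 + c ^+ 2) -
    (2 * a * (- mu * a - c + (y1 + y2) * b) +
     2 * b * (- mu * b - a + (y2 + y0) * c) +
     2 * c * (- mu * c - b + (y0 + y1) * a)).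
  have rest0 : 0 <= rest by rewrite /rest /k; lra.
  rewrite [leRHS](_ : _ = E * rest); first by rewrite mulr_ge0.
  by rewrite /rest /a /b /c; ring.
rewrite /g /D /sq /=.
rewrite /g /D /sq /= x0 !mxE !subrr !mulr0 !addr0 oppr0 mulr0.
rewrite pmulr_rge0 ?expR_gt0// oppr_ge0 => sT.
apply/eqP; rewrite -subr_eq0 -sqrf_eq0 eq_le sqr_ge0 andbT.
apply: le_trans sT; rewrite expr2 -addrA lerDl.
by rewrite addr_ge0// -expr2 sqr_ge0.
Qed.

End necessity.

Lemma nbhs0_scale (R : realType) (V : normedModType R) (A : set V) (v : V) :
  nbhs 0 A -> exists2 r : R, 0 < r & A (r *: v).
Proof.
move=> /nbhs_ballP[e /= e0 eA].
exists (e / 2 / (`|v| + 1)); first by rewrite !divr_gt0// ltr_wpDl.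
apply: eA; rewrite -ball_normE/= sub0r normrN normrZ.
have v0 : 0 < `|v| + 1 by rewrite ltr_wpDl.
rewrite gtr0_norm; last by rewrite !divr_gt0.
apply: (@le_lt_trans _ _ (e / 2)); last lra.
by rewrite mulrAC ler_pdivrMr// ler_wpM2l ?lerDl// divr_ge0// ltW.
Qed.

(** An invariant of all trajectories that fails along a ray from the origin
rules out that the reachable set is a neighbourhood. *)
Lemma stlc_escape (R : realType) (mu : R) (f : 'cV[R]_3) (U : set R)
    (P : 'cV[R]_3 -> Prop) (v : 'cV[R]_3) :
  (forall T u x, 0 <= T -> x 0 = 0 ->
    admissible_trajectory (sprott_drift mu) f T u x -> P (x T)) ->
  (forall r, 0 < r -> ~ P (r *: v)) ->
  ~ stlc (sprott_drift mu) f U 0.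
Proof.
move=> trP nP /(_ 1 ltr01) nb.
have [r r0 [T + [u [x [_ trx x0 xT]]]]] := nbhs0_scale v nb.
rewrite /= in_itv/= => /andP[T0 _]; apply: (nP r r0).
by rewrite -xT; exact: trP trx.
Qed.

Lemma stlc_necessary (R : realType) (mu : R) (f : 'cV[R]_3) (U : set R) :
  stlc (sprott_drift mu) f U 0 ->
  ~ (span_ones `|` orthogonal_complement span_ones) f.
Proof.
move=> + [/= /vlineP[c fE]|fperp].
  apply: (@stlc_escape _ _ _ _ (fun y => y i0 0 = y i1 0) (delta_mx i0 0)).
    by move=> T u x T0 x0 trx; exact: (coord_eq T0 x0 trx fE).
  by move=> r r0; rewrite !mxE/= mulr1 mulr0 => r_eq; rewrite r_eq ltxx in r0.
have f0 : dotv f ones = 0.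
  have <- : dotv ones f = 0 by apply: fperp => /=; exact: memv_line.
  by rewrite /dotv; apply: eq_bigr => i _; rewrite mulrC.
apply: (@stlc_escape _ _ _ _ (fun y => 0 <= y i0 0 + y i1 0 + y i2 0) (- ones)).
  by move=> T u x T0 x0 trx; exact: (sum_coord_ge0 T0 x0 trx f0).
by move=> r r0; rewrite !mxE; lra.
Qed.

(** * Primitives and fixed points of curves *)

Lemma mx_norm_leP (R : realType) (m n : nat) (A : 'M[R]_(m, n)) (M : R) :
  0 <= M -> (forall i j, `|A i j| <= M) -> `|A| <= M.
Proof.
by move=> M0 AM; rewrite [leLHS]/Num.norm/= mx_normrE bigmax_le// => i _.
Qed.

(** Integrating from -1 makes the primitive differentiable at 0 as well, which
spares the treatment of the left endpoint of the time interval. *)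
Lemma real_primitive (R : realType) (g : R -> R) : continuous g ->
  exists2 G : R -> R, G 0 = 0 & forall t : R, -1 < t -> is_derive t 1 G (g t).
Proof.
move=> cg.
pose F (y : R) := \int[lebesgue_measure]_(t in `[-1, y]) g t.
exists (fun y => F y - F 0) => [|t t1]; first by rewrite subrr.
have tt1 : t < t + 1 by rewrite ltrDl.
have intg : lebesgue_measure.-integrable [set` `[-1, t + 1]] (EFin \o g).
  apply: continuous_compact_integrable; first exact: segment_compact.
  exact: continuous_subspaceT.
have [|Ft dF] := continuous_FTC1 tt1 intg _ (cg t).
  by rewrite lte_fin.
have dFt : is_derive t 1 F (g t) by split=> //; rewrite -derive1E.
by apply: is_derive_eq; rewrite subr0.
Qed.

Lemma primitive (R : realType) (n : nat) (g : R -> 'cV[R]_n) : continuous g ->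
  exists2 G : R -> 'cV[R]_n, G 0 = 0 &
    forall t : R, -1 < t -> is_derive t 1 G (g t).
Proof.
move=> cg.
have cgi i : continuous (fun t => g t i 0).
  move=> t; apply/cvgrPdist_lt => e e0.
  have /cvgrPdist_lt/(_ _ e0) := cg t; apply: filterS => s.
  by apply: le_lt_trans; have := ler_coord_norm (g t - g s) i 0; rewrite !mxE.
pose G i := sval (cid2 (real_primitive (cgi i))).
have G0 i : G i 0 = 0 by rewrite /G; case: cid2.
have dG i (t : R) : -1 < t -> is_derive t 1 (G i) (g t i 0).
  by rewrite /G; case: cid2 => /= H _; exact.
exists (fun t => \col_i G i t) => [|t t1].
  by apply/colP => i; rewrite !mxE.
have dcol : derivable (fun t => \col_i G i t) t 1.
  apply/derivable_mxP => i j; under eq_fun do rewrite mxE.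
  by have [] := dG i t t1.
split=> //; rewrite derive_mx//; apply/colP => i; rewrite !mxE.
under eq_fun do rewrite mxE.
by have [] := dG i t t1.
Qed.

Lemma is_derive_continuous (R : realType) (V : normedModType R) (x : R -> V)
  (t : R) (dx : V) : is_derive t 1 x dx -> {for t, continuous x}.
Proof.
by move=> [xt _]; apply: differentiable_continuous; apply/derivable1_diffP.
Qed.

(** The sup norm reduces the vector-valued mean value inequality to the scalar
mean value theorem in each coordinate. *)
Lemma mean_value_le (R : realType) (n : nat) (x dx : R -> 'cV[R]_n) (M s t : R) :
  s <= t -> 0 <= M ->
  (forall r : R, r \in `[s, t] -> is_derive r 1 x (dx r)) ->
  (forall r, r \in `[s, t] -> `|dx r| <= M) ->
  `|x t - x s| <= M * (t - s).
Proof.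
move=> st M0 xdx dxM.
apply: mx_norm_leP => [|i j]; first by rewrite mulr_ge0// subr_ge0.
have d (r : R) : r \in `[s, t] -> is_derive r 1 (fun r => x r i j) (dx r i j).
  by move=> /xdx; exact: is_derive_coord.
have d' (r : R) : r \in `]s, t[ -> is_derive r 1 (fun r => x r i j) (dx r i j).
  by move=> rst; apply: d; exact: subset_itv_oo_cc.
have c : {within `[s, t], continuous (fun r => x r i j)}.
  apply: continuous_in_subspaceT => r; rewrite inE/= => rst.
  exact: is_derive_continuous (d r rst).
have [r rst] := MVT_segment st d' c.
rewrite !mxE => ->; rewrite normrM (ger0_norm (_ : 0 <= t - s)) ?subr_ge0//.
rewrite ler_wpM2r ?subr_ge0//.
exact: le_trans (ler_coord_norm _ _ _) (dxM _ rst).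
Qed.

Section sup_contraction.
Context {R : realType} {n : nat}.
Variables (rho : R) (Phi : (R -> 'cV[R]_n) -> R -> 'cV[R]_n).

Definition bounded_curve (z : R -> 'cV[R]_n) : Prop :=
  continuous z /\ forall t, `|z t| <= rho.

Hypothesis rho0 : 0 <= rho.
Hypothesis PhiB : forall z, bounded_curve z -> bounded_curve (Phi z).
Hypothesis PhiC : forall z z' e, bounded_curve z -> bounded_curve z' ->
  (forall t, `|z t - z' t| <= e) -> forall t, `|Phi z t - Phi z' t| <= e / 2.

Let zs k := iter k Phi (fun=> 0).

Let zsB k : bounded_curve (zs k).
Proof.
elim: k => [|k IH]; last exact: PhiB.
by split=> [|t]; [exact: cst_continuous|rewrite normr0].
Qed.

Let zs_close k l t : `|zs (k + l) t - zs k t| <= rho / 2 ^+ k.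
Proof.
elim: k t => [|k IH] t.
  by rewrite /zs/= subr0 expr0 divr1; exact: (zsB l).2.
by have := PhiC (zsB (k + l)) (zsB k) IH t; rewrite exprSr invfM mulrA.
Qed.

Let small (e : R) : 0 < e -> exists k, rho / 2 ^+ k < e.
Proof.
move=> e0; exists (Num.bound (rho / e)).
rewrite ltr_pdivrMr ?exprn_gt0// mulrC -ltr_pdivrMr//.
apply: lt_trans (archi_boundP (divr_ge0 rho0 (ltW e0))) _.
by rewrite -natrX ltr_nat ltn_expl.
Qed.

Let zs_cvg t : cvg (zs ^~ t @ \oo).
Proof.
apply/cauchy_cvgP/cauchy_exP => e e0; have [k kP] := small e0.
exists (zs k t); exists k => // l /= kl.
rewrite -ball_normE/= distrC; apply: le_lt_trans kP.
by rewrite -(subnKC kl).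
Qed.

Let z t := lim (zs ^~ t @ \oo).

Let zs_lim k t : `|z t - zs k t| <= rho / 2 ^+ k.
Proof.
apply/ler_addgt0Pr => e e0.
have zt : zs ^~ t @ \oo --> z t by exact: zs_cvg.
move/cvgrPdist_lt : zt => /(_ _ e0)[N _ NP].
have h2 := ltW (NP (N + k)%N (leq_addr _ _)).
have := zs_close k N t; rewrite addnC => h1.
rewrite -(subrKA (zs (N + k)%N t)); apply: (le_trans (ler_normD _ _)).
by rewrite /= in h2 *; lra.
Qed.

(** Banach's fixed point theorem on the bounded continuous curves. The iterates
start at 0, and the [k]-th one is within [rho / 2 ^ k] of all later ones. *)
Lemma sup_contraction_fixpoint :
  exists2 z : R -> 'cV[R]_n, bounded_curve z & forall t, Phi z t = z t.
Proof.
have zB : bounded_curve z.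
  split=> t; last first.
    apply/ler_addgt0Pr => e e0; have [k kP] := small e0.
    have := zs_lim k t; have := (zsB k).2 t => h1 h2.
    rewrite -(subrK (zs k t) (z t)); apply: (le_trans (ler_normD _ _)); lra.
  apply/cvgrPdist_lt => e e0; have e3 : 0 < e / 3 by lra.
  have [k kP] := small e3.
  have /cvgrPdist_lt/(_ _ e3) := (zsB k).1 t; apply: filterS => s ts.
  have := zs_lim k t; have := zs_lim k s; rewrite distrC => h1 h2.
  have -> : z t - z s = (z t - zs k t) + (zs k t - zs k s) + (zs k s - z s).
    by rewrite !subrKA.
  apply: (le_lt_trans (ler_normD _ _)).
  have := ler_normD (z t - zs k t) (zs k t - zs k s); lra.
exists z => // t; apply/eqP; rewrite -subr_eq0 -normr_eq0 eq_le normr_ge0 andbT.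
apply/ler_addgt0Pr => e e0; have [k kP] := small e0.
have h1 := PhiC zB (zsB k) (zs_lim k) t.
have h2 := zs_lim k.+1 t; rewrite distrC in h2.
have -> : Phi z t - z t = (Phi z t - zs k.+1 t) + (zs k.+1 t - z t).
  by rewrite subrKA.
apply: (le_trans (ler_normD _ _)).
rewrite exprSr invfM mulrA in h2; rewrite /= in h2 h1 *; lra.
Qed.

End sup_contraction.

(** * Sawtooth functions *)

Lemma near_eq_is_derive1 (R : realType) (g g' : R -> R) (t d : R) :
  {near t, g =1 g'} -> is_derive t 1 g d -> is_derive t 1 g' d.
Proof.
move=> gg' [gt <-]; split; first exact: near_eq_derivable gt.
by apply/esym; apply: near_eq_derive.
Qed.

Lemma max_lipschitz (R : realType) (x y x' y' c : R) :
  `|x - x'| <= c -> `|y - y'| <= c -> `|Num.max x y - Num.max x' y'| <= c.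
Proof.
rewrite !ler_norml => /andP[? ?] /andP[? ?].
by case: (leP x y) => ?; case: (leP x' y') => ?; lra.
Qed.

Lemma min_lipschitz (R : realType) (x y x' y' c : R) :
  `|x - x'| <= c -> `|y - y'| <= c -> `|Num.min x y - Num.min x' y'| <= c.
Proof.
rewrite !ler_norml => /andP[? ?] /andP[? ?].
by case: (leP x y) => ?; case: (leP x' y') => ?; lra.
Qed.

Section sawtooth.
Context {R : realType}.
Variables (a b h : R) (N : nat).
Implicit Types (w : R -> R) (s t : R) (j k : nat).
Hypotheses (ab : a < b) (h0 : 0 < h) (N0 : (0 < N)%N).

Let T : R := N%:R * h.

Let node j : R := j%:R * h.

(** On the [j]-th cell the tent rises from the graph of [w] with slope [b] and
then falls with slope [a] back to the graph of [w]. *)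
Definition tent w j t : R :=
  Num.min (w (node j) + b * (t - node j)) (w (node j.+1) + a * (t - node j.+1)).

(** Taking a maximum of all tents, instead of choosing the tent of the current
cell, makes the Lipschitz bound immediate; the two agree by [sawtooth_cell]. *)
Definition sawtooth w t : R := \big[Num.max/tent w 0 t]_(j < N) tent w j t.

Let nodeS j : node j.+1 = node j + h.
Proof. by rewrite /node -natr1 mulrDl mul1r. Qed.

Let node_le j k : (j <= k)%N -> node j <= node k.
Proof. by move=> jk; rewrite ler_wpM2r ?ler_nat// ltW. Qed.

Let node_ge0 j : 0 <= node j.
Proof. by rewrite mulr_ge0// ltW. Qed.

Let node_itv j : (j <= N)%N -> node j \in `[0, T].
Proof. by move=> jN; rewrite in_itv/= node_ge0 node_le. Qed.

Lemma node_cell t : t \in `[0, T] ->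
  exists2 k, (k < N)%N & node k <= t <= node k.+1.
Proof.
rewrite in_itv/= => /andP[t0]; rewrite /T -/(node N).
elim: N N0 => // -[_ _ tT|n IH _ tT].
  by exists 0%N => //; rewrite tT /node mul0r t0.
have [tn|nt] := leP t (node n.+1); last by exists n.+1; rewrite ?(ltW nt).
by have [k kn kt] := IH isT tn; exists k => //; rewrite ltnS ltnW.
Qed.

Definition slope_bounded w : Prop :=
  forall s t, s \in `[0, T] -> t \in `[0, T] -> s <= t ->
    a * (t - s) <= w t - w s <= b * (t - s).

Section tents.
Variable w : R -> R.
Hypothesis ww : slope_bounded w.

Lemma le_tent t k : (k < N)%N -> node k <= t <= node k.+1 ->
  w t <= tent w k t.
Proof.
move=> kN /andP[kt tk]; have tT : t \in `[0, T].
  rewrite in_itv/= (le_trans (node_ge0 k) kt) (le_trans tk)//.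
  exact: node_le.
rewrite /tent le_min.
have /andP[_ h1] := ww (node_itv (ltnW kN)) tT kt.
have /andP[h2 _] := ww tT (node_itv kN) tk.
by apply/andP; split; lra.
Qed.

Lemma tent_le t j k : (j < N)%N -> (k < N)%N -> j != k ->
  node k <= t <= node k.+1 -> tent w j t <= w t.
Proof.
move=> jN kN jk /andP[kt tk]; have tT : t \in `[0, T].
  rewrite in_itv/= (le_trans (node_ge0 k) kt) (le_trans tk)//.
  exact: node_le.
rewrite /tent ge_min; have [jk'|kj|/eqP] := ltngtP j k; last by rewrite (negPf jk).
  have jt : node j.+1 <= t by apply: le_trans kt; exact: node_le.
  have /andP[h1 _] := ww (node_itv jN) tT jt.
  by apply/orP; right; lra.
have tj : t <= node j by apply: le_trans tk _; exact: node_le.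
have /andP[_ h1] := ww tT (node_itv (ltnW jN)) tj.
by apply/orP; left; lra.
Qed.

(** Outside its own cell a tent lies below [w], hence below the tent of the
cell. *)
Lemma sawtooth_cell t k : (k < N)%N -> node k <= t <= node k.+1 ->
  sawtooth w t = tent w k t.
Proof.
move=> kN kt; apply/eqP; rewrite eq_le; apply/andP; split; last first.
  exact: (le_bigmax _ (fun j : 'I_N => tent w j t) (Ordinal kN)).
have le_j j : (j < N)%N -> tent w j t <= tent w k t.
  move=> jN; have [->//|jk] := eqVneq j k.
  exact: le_trans (tent_le jN kN jk kt) (le_tent kN kt).
by apply: bigmax_le => [|j _]; apply: le_j.
Qed.

Lemma sawtooth_approx t : t \in `[0, T] ->
  0 <= sawtooth w t - w t <= (b - a) * h.
Proof.
move=> tT; have [k kN kt] := node_cell tT.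
rewrite (sawtooth_cell kN kt) subr_ge0 le_tent//=.
have /andP[kt1 kt2] := kt.
have /andP[h1 _] := ww (node_itv (ltnW kN)) tT kt1.
have : tent w k t <= w (node k) + b * (t - node k) by rewrite ge_min lexx.
have : (b - a) * (t - node k) <= (b - a) * h.
  by rewrite nodeS in kt2; apply: ler_wpM2l; [rewrite subr_ge0 ltW|lra].
lra.
Qed.

Lemma sawtooth0 : sawtooth w 0 = w 0.
Proof.
have k0 : node 0 <= 0 <= node 1 by rewrite /node mul0r lexx mul1r ltW.
rewrite (sawtooth_cell N0 k0); apply/eqP; rewrite eq_le le_tent// andbT.
by rewrite /tent ge_min /node mul0r subrr mulr0 addr0 lexx.
Qed.

Lemma sawtoothT : sawtooth w T = w T.
Proof.
have NN : (N.-1 < N)%N by rewrite prednK.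
have kT : node N.-1 <= T <= node N.-1.+1.
  by rewrite prednK// lexx node_le// leq_pred.
rewrite (sawtooth_cell NN kT); apply/eqP; rewrite eq_le le_tent// andbT.
by rewrite /tent ge_min prednK// -/T subrr mulr0 addr0 lexx orbT.
Qed.

End tents.

(** The point of this construction: not only is the sawtooth close to [w], the
error also depends on [w] with a Lipschitz constant of order [h]. This is what
keeps the correction of the steering a contraction. *)
Lemma sawtooth_contraction w w' c t : slope_bounded w -> slope_bounded w' ->
  0 <= c ->
  (forall s t, s \in `[0, T] -> t \in `[0, T] -> s <= t ->
     `|(w t - w' t) - (w s - w' s)| <= c * (t - s)) ->
  t \in `[0, T] ->
  `|(sawtooth w t - w t) - (sawtooth w' t - w' t)| <= c * h.
Proof.
move=> ws ws' c0 ww' tT; have [k kN kt] := node_cell tT.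
rewrite (sawtooth_cell ws kN kt) (sawtooth_cell ws' kN kt).
have /andP[kt1 kt2] := kt.
have := ww' _ _ (node_itv (ltnW kN)) tT kt1.
have := ww' _ _ tT (node_itv kN) kt2.
have : c * (t - node k) <= c * h.
  by rewrite ler_wpM2l//; rewrite nodeS in kt2; lra.
have : c * (node k.+1 - t) <= c * h.
  by rewrite ler_wpM2l//; rewrite nodeS; lra.
move=> c1 c2 d1 d2; rewrite /tent (addr_minl _ _ (- w t)) (addr_minl _ _ (- w' t)).
apply: min_lipschitz.
  by move: d2; rewrite !ler_norml => /andP[? ?]; apply/andP; split; lra.
by move: d1; rewrite !ler_norml => /andP[? ?]; apply/andP; split; lra.
Qed.

Lemma sawtooth_lipschitz w s t : s <= t ->
  `|sawtooth w t - sawtooth w s| <= (`|a| + `|b|) * (t - s).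
Proof.
move=> st.
have tentL j : `|tent w j t - tent w j s| <= (`|a| + `|b|) * (t - s).
  apply: min_lipschitz.
    rewrite (_ : _ - _ = b * (t - s)); last by ring.
    rewrite normrM (ger0_norm (_ : 0 <= t - s)) ?subr_ge0// ler_wpM2r ?subr_ge0//.
    by rewrite lerDr.
  rewrite (_ : _ - _ = a * (t - s)); last by ring.
  rewrite normrM (ger0_norm (_ : 0 <= t - s)) ?subr_ge0// ler_wpM2r ?subr_ge0//.
  by rewrite lerDl.
rewrite /sawtooth; elim/big_ind2 : _ => // x1 x2 y1 y2 hx hy.
exact: max_lipschitz.
Qed.

Section control.
Variable w : R -> R.
Hypothesis ww : slope_bounded w.

Let switch j : R :=
  (w (node j.+1) - w (node j) + b * node j - a * node j.+1) / (b - a).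

Let tent_rise j t : t < switch j -> tent w j t = w (node j) + b * (t - node j).
Proof.
by rewrite /switch ltr_pdivlMr ?subr_gt0// => ht; apply: min_idPl; lra.
Qed.

Let tent_fall j t : switch j < t ->
  tent w j t = w (node j.+1) + a * (t - node j.+1).
Proof.
by rewrite /switch ltr_pdivrMr ?subr_gt0// => ht; apply: min_idPr; lra.
Qed.

Let switch_le j : (j < N)%N -> switch j <= node j.+1.
Proof.
move=> jN; rewrite /switch ler_pdivrMr ?subr_gt0//.
have /andP[_ h1] := ww (node_itv (ltnW jN)) (node_itv jN) (node_le (leqnSn j)).
lra.
Qed.

Let rising : set R := \bigcup_(j in `I_N) `[node j, switch j[%classic.

Let kinks : set R := \bigcup_(j in `I_N.+1) [set node j; switch j].

Let kinks_null : lebesgue_measure kinks = 0%E.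
Proof.
apply: countable_lebesgue_measure0; apply: finite_set_countable.
by apply: bigcup_finite => // j _; rewrite finite_setU; split; exact: finite_set1.
Qed.

Let u t : R := a + (b - a) * \1_rising t.

Let u_rise t : rising t -> u t = b.
Proof. by move=> tr; rewrite /u indicE mem_set// mulr1 addrC subrK. Qed.

Let u_fall t : ~ rising t -> u t = a.
Proof. by move=> tr; rewrite /u indicE memNset// mulr0 addr0. Qed.

(** The sawtooth is the integral of a control that takes only the two values
[a] and [b]; its derivative fails to exist only at the finitely many kinks. *)
Lemma sawtooth_control : exists u : R -> R,
  [/\ forall t, u t = a \/ u t = b,
      lebesgue_measure.-integrable `[0, T] (EFin \o u)
    & {ae lebesgue_measure, forall t, t \in `[0, T] ->
        is_derive t 1 (sawtooth w) (u t)}].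
Proof.
exists u; split.
- by move=> t; have [/u_rise|/u_fall] := pselect (rising t); [right|left].
- have mu : measurable_fun setT u.
    apply: measurable_funD => //; apply: measurable_funM => //.
    by apply: measurable_indic; apply: bigcup_measurable.
  apply: measurable_bounded_integrable => //.
  + by rewrite [X in (X < _)%E]lebesgue_measure_itv/=; case: ifP => _; rewrite ltry.
  + exact: measurable_funS mu.
  + exists (`|a| + `|b|); split; first exact: num_real.
    move=> y hy t _ /=; apply: le_trans (ltW hy).
    by have [/u_rise|/u_fall] := pselect (rising t) => ->; rewrite ?lerDl ?lerDr.
- have mk : measurable kinks.
    by apply: bigcup_measurable => j _; apply: measurableU.
  exists kinks; split => //.
  move=> t /= nt; apply: contrapT => tk; apply: nt => tT.
  have [k kN /andP[kt tk']] := node_cell tT.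
  have {}kt : node k < t.
    rewrite lt_neqAle kt andbT; apply/eqP => E; apply: tk.
    by exists k; [exact: ltnW|left].
  have {}tk' : t < node k.+1.
    rewrite lt_neqAle tk' andbT; apply/eqP => E; apply: tk.
    by exists k.+1 => //; left.
  have near_cell : \forall s \near t, sawtooth w s = tent w k s.
    near=> s; apply: sawtooth_cell => //; apply/andP; split.
      by near: s; apply: filterS (lt_nbhsr kt) => s /ltW.
    by near: s; apply: filterS (lt_nbhsl tk') => s /ltW.
  have slope c (y v : R) : is_derive t 1 (fun s : R => y + c * (s - v)) c.
    by apply: is_derive_eq; rewrite /GRing.scale/=; ring.
  have [tsw|swt|tsw] := ltgtP t (switch k).
  + have -> : u t = b.
      by apply: u_rise; exists k => //=; rewrite in_itv/= (ltW kt).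
    apply: near_eq_is_derive1 (slope b (w (node k)) (node k)).
    near=> s; rewrite (near near_cell s)// tent_rise//.
    by near: s; exact: lt_nbhsl.
  + have -> : u t = a.
      apply: u_fall => -[j /= jN]; rewrite in_itv/= => /andP[jt tj].
      have [jk|kj|jk] := ltngtP j k.
      * have := le_trans (switch_le jN) (node_le jk); lra.
      * have := node_le kj; lra.
      * by rewrite jk in tj; lra.
    apply: near_eq_is_derive1 (slope a (w (node k.+1)) (node k.+1)).
    near=> s; rewrite (near near_cell s)// tent_fall//.
    by near: s; exact: lt_nbhsr.
  + by exfalso; apply: tk; exists k; [exact: ltnW|right].
Unshelve. all: by end_near. Qed.

End control.

End sawtooth.

(** * From linear steering to bang-bang steering of the nonlinear system *)

Lemma sub_segment (R : realType) (T s t x : R) :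
  s \in `[0, T] -> t \in `[0, T] -> x \in `[s, t] -> x \in `[0, T].
Proof.
rewrite !in_itv/= => /andP[? ?] /andP[? ?] /andP[? ?].
by apply/andP; split; lra.
Qed.

(** Open-loop steering of [x' = A x + v f] from 0 to [p] in time [T], with [w
p] a primitive of the control [v p], and with curve and control depending on
the target [p] in a Lipschitz way. *)
Record linear_steering (R : realType) (n : nat) (A : 'M[R]_n) (f : 'cV[R]_n)
    (T C : R) (X : 'cV[R]_n -> R -> 'cV[R]_n) (v w : 'cV[R]_n -> R -> R) : Prop :=
  LinearSteering {
    steering_curve : forall p (t : R),
      is_derive t 1 (X p) (A *m X p t + v p t *: f);
    steering_primitive : forall p (t : R), is_derive t 1 (w p) (v p t);
    steering_start : forall p, X p 0 = 0;
    steering_end : forall p, X p T = p;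
    steering_curve_le : forall p p' t, t \in `[0, T] ->
      `|X p t - X p' t| <= C * `|p - p'|;
    steering_control_le : forall p p' t, t \in `[0, T] ->
      `|v p t - v p' t| <= C * `|p - p'|;
    steering_curve0 : forall t, X 0 t = 0;
    steering_control0 : forall t, v 0 t = 0 }.

Lemma lipschitz_continuous (R : realType) (V W : normedModType R) (g : V -> W)
    (x : V) (r k : R) : 0 < r ->
  (forall y, `|x - y| < r -> `|g x - g y| <= k * `|x - y|) ->
  {for x, continuous g}.
Proof.
move=> r0 gk; apply/cvgrPdist_lt => e e0.
have k1 : 0 < Num.max k 0 + 1 by rewrite ltr_wpDl// le_max lexx orbT.
near=> y.
have xyr : `|x - y| < r by near: y; exact: cvgr_dist_lt.
have xye : `|x - y| < e / (Num.max k 0 + 1).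
  by near: y; apply: cvgr_dist_lt => //; exact: divr_gt0.
apply: le_lt_trans (gk _ xyr) _.
move: xye; rewrite ltr_pdivlMr// mulrC; apply: le_lt_trans.
by rewrite ler_wpM2r// ler_wpDr// le_max lexx.
Unshelve. all: by end_near. Qed.

Lemma le_MVT (R : realType) (g dg : R -> R) (m M s t : R) : s <= t ->
  (forall r : R, is_derive r 1 g (dg r)) ->
  (forall r, r \in `[s, t] -> m <= dg r <= M) ->
  m * (t - s) <= g t - g s <= M * (t - s).
Proof.
move=> st gdg dgM.
have d' r : r \in `]s, t[ -> is_derive r 1 g (dg r) by move=> _.
have cg : {within `[s, t], continuous g}.
  apply: continuous_subspaceT => r.
  exact: is_derive_continuous (gdg r).
have [r rst ->] := MVT_segment st d' cg.
by have /andP[? ?] := dgM _ rst; rewrite !ler_wpM2r// subr_ge0.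
Qed.

Lemma is_deriveZr (R : realType) (V : normedModType R) (g : R -> R) (y : V)
    (t d : R) :
  is_derive t 1 g d -> is_derive t 1 (fun s => g s *: y) (d *: y).
Proof.
move=> [gt <-].
suff H : (fun s : R => s^-1 *: (g (s *: 1 + t) *: y - g t *: y)) @ 0^' -->
    'D_1 g t *: y.
  split; first by apply/cvg_ex; exists ('D_1 g t *: y).
  by apply: cvg_lim H.
have -> : (fun s : R => s^-1 *: (g (s *: 1 + t) *: y - g t *: y)) =
    (fun s : R => (s^-1 *: (g (s *: 1 + t) - g t)) *: y).
  by apply/funext => s; rewrite -scalerBl scalerA.
by apply: cvgZr_tmp; exact: gt.
Qed.

Definition primitive_of (R : realType) (n : nat) (g : R -> 'cV[R]_n) :
    R -> 'cV[R]_n :=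
  xget (fun=> 0) [set G | G 0 = 0 /\
    forall t : R, -1 < t -> is_derive t 1 G (g t)].

Lemma primitive_ofP (R : realType) (n : nat) (g : R -> 'cV[R]_n) :
  continuous g -> primitive_of g 0 = 0 /\
    forall t : R, -1 < t -> is_derive t 1 (primitive_of g) (g t).
Proof.
move=> /primitive[G G0 dG].
have H : [set G | G 0 = 0 /\
    forall t : R, -1 < t -> is_derive t 1 G (g t)] G by split.
exact: (xgetI (fun=> 0) H).
Qed.

(** Here [A x + Q x] is the drift, and [q] the target. The unknown is the part
[z] of the trajectory that remains after subtracting the linear steering to [q
- z T] and the sawtooth defect. It solves a fixed point equation in which the
target of the linear steering depends on [z] itself, so that solving the
differential equation and hitting [q] are a single contraction. *)
Section correction.
Context {R : realType} {n : nat}.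
Variables (A : 'M[R]_n) (Q : 'cV[R]_n -> 'cV[R]_n) (f : 'cV[R]_n).
Variables (l k r rho T C a b h : R) (N : nat).
Variables (X : 'cV[R]_n -> R -> 'cV[R]_n) (v w : 'cV[R]_n -> R -> R).
Variable q : 'cV[R]_n.

Hypothesis l0 : 0 <= l.
Hypothesis Al : forall x : 'cV[R]_n, `|A *m x| <= l * `|x|.
Hypothesis k0 : 0 <= k.
Hypothesis Q0 : Q 0 = 0.
Hypothesis Qlip : forall s x y, `|x| <= s -> `|y| <= s ->
  `|Q x - Q y| <= k * s * `|x - y|.
Hypothesis T0 : 0 < T.
Hypothesis C0 : 0 <= C.
Hypothesis st : linear_steering A f T C X v w.
Hypotheses (a0 : a < 0) (b0 : 0 < b) (r0 : 0 < r) (rho0 : 0 < rho).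
Hypotheses (N0 : (0 < N)%N) (h0 : 0 < h) (TN : T = N%:R * h).
Hypothesis q_le : `|q| <= rho.

Let D := (b - a) * h * `|f|.

Hypotheses (small_a : C * (2 * rho) <= - a) (small_b : C * (2 * rho) <= b).
Hypothesis small_h : C * h * `|f| <= 1.
Hypothesis small_r : rho + C * (2 * rho) + D <= r.
Hypothesis small_T : T * (2 * l + k * r * (2 + C)) <= 1 / 2.
Hypothesis small_self :
  T * (l * (rho + D) + k * r * (rho + C * (2 * rho) + D)) <= rho.

Let ab : a < b. Proof. exact: lt_trans b0. Qed.

Let saw (p : 'cV[R]_n) : R -> R := sawtooth a b h N (w p).
Let defect (p : 'cV[R]_n) (t : R) : R := saw p t - w p t.

Let target (z : R -> 'cV[R]_n) : 'cV[R]_n := q - z T.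
Let curve (z : R -> 'cV[R]_n) (t : R) : 'cV[R]_n :=
  z t + X (target z) t + defect (target z) t *: f.
Let speed (z : R -> 'cV[R]_n) (t : R) : 'cV[R]_n :=
  A *m (z t + defect (target z) t *: f) + Q (curve z t).
(** Freezing curves outside [0, T] lets sup norms range over the whole line. *)
Let clamp (t : R) : R := Num.max 0 (Num.min t T).
Let step (z : R -> 'cV[R]_n) (t : R) : 'cV[R]_n := primitive_of (speed z) (clamp t).

Let clampI t : clamp t \in `[0, T].
Proof.
by rewrite in_itv/= /clamp le_max lexx/= ge_max (ltW T0)/= ge_min lexx orbT.
Qed.

Let clamp_id t : t \in `[0, T] -> clamp t = t.
Proof.
by rewrite in_itv/= /clamp => /andP[t0 tT]; rewrite (min_idPl tT) (max_idPr t0).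
Qed.

Let A_continuous : continuous (fun x : 'cV[R]_n => A *m x).
Proof.
move=> x; apply: (@lipschitz_continuous _ _ _ _ _ 1 l) => // y _.
by rewrite -mulmxBr.
Qed.

Let Q_continuous : continuous Q.
Proof.
move=> x; apply: (@lipschitz_continuous _ _ _ _ _ 1 (k * (`|x| + 1))) => // y xy.
apply: Qlip; first by rewrite lerDl.
rewrite -[y in leLHS](subrK x); apply: le_trans (ler_normD _ _) _.
by rewrite addrC lerD2l distrC ltW.
Qed.

Let control_le (p : 'cV[R]_n) (t : R) : t \in `[0, T] -> `|v p t| <= C * `|p|.
Proof.
move=> tT; have := steering_control_le st p 0 tT.
by rewrite (steering_control0 st) !subr0.
Qed.

Let curve_le (p : 'cV[R]_n) (t : R) : t \in `[0, T] -> `|X p t| <= C * `|p|.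
Proof.
move=> tT; have := steering_curve_le st p 0 tT.
by rewrite (steering_curve0 st) !subr0.
Qed.

Let w_slope (p : 'cV[R]_n) : `|p| <= 2 * rho -> slope_bounded a b h N (w p).
Proof.
move=> p_le s t; rewrite -TN => sT tT s_t.
have := @le_MVT _ (w p) (v p) a b s t s_t (steering_primitive st p).
apply=> u us; have uT := sub_segment sT tT us.
have := control_le p uT.
have : C * `|p| <= C * (2 * rho) by rewrite ler_wpM2l.
have := small_a; have := small_b.
by rewrite ler_norml => ? ? ? /andP[? ?]; apply/andP; split; lra.
Qed.

Let defect_le (p : 'cV[R]_n) (t : R) : `|p| <= 2 * rho -> t \in `[0, T] ->
  `|defect p t| <= (b - a) * h.
Proof.
move=> p_le; rewrite TN => tT.
have /andP[h1 h2] := sawtooth_approx ab h0 N0 (w_slope p_le) tT.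
by rewrite ger0_norm.
Qed.

Let defect_lip (p p' : 'cV[R]_n) (e t : R) : `|p| <= 2 * rho -> `|p'| <= 2 * rho ->
  `|p - p'| <= e -> t \in `[0, T] ->
  `|defect p t - defect p' t| <= C * e * h.
Proof.
move=> p_le p'_le pp'; rewrite TN => tT.
have e0 : 0 <= e by exact: le_trans pp'.
apply: (sawtooth_contraction h0 N0 (w_slope p_le) (w_slope p'_le)) => //.
  exact: mulr_ge0.
move=> s u; rewrite -TN => sT uT su.
rewrite ler_norml -mulNr.
have dw (x : R) : is_derive x 1 (fun x => w p x - w p' x) (v p x - v p' x).
  have := steering_primitive st p x; have := steering_primitive st p' x.
  by move=> d1 d2; apply: is_derive_eq.
have := @le_MVT _ (fun x => w p x - w p' x) (fun x => v p x - v p' x)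
  (- (C * e)) (C * e) s u su dw.
apply=> x xs; have xT := sub_segment sT uT xs.
rewrite -ler_norml; apply: le_trans (steering_control_le st p p' xT) _.
exact: ler_wpM2l.
Qed.

Let defect_continuous p : continuous (defect p).
Proof.
move=> t; apply: continuousB; last first.
  exact: is_derive_continuous (steering_primitive st p t).
apply: (@lipschitz_continuous _ _ _ _ _ 1 (`|a| + `|b|)) => // s _.
case: (leP s t) => [st'|/ltW st'].
  by rewrite (ger0_norm (_ : 0 <= t - s)) ?subr_ge0//; exact: sawtooth_lipschitz.
rewrite distrC [in leRHS]distrC (ger0_norm (_ : 0 <= s - t)) ?subr_ge0//.
exact: sawtooth_lipschitz.
Qed.

Let target_le z : bounded_curve rho z -> `|target z| <= 2 * rho.
Proof.
move=> [_ zr]; apply: le_trans (ler_normB _ _) _.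
by have := zr T; have := q_le; lra.
Qed.

Let base_continuous z : bounded_curve rho z ->
  continuous (fun t => z t + defect (target z) t *: f).
Proof.
move=> [cz _] t; apply: cvgD; first exact: cz.
by apply: cvgZr_tmp; exact: defect_continuous.
Qed.

Let speed_continuous z : bounded_curve rho z -> continuous (speed z).
Proof.
move=> zB t; apply: cvgD.
  apply: (@continuous_comp _ _ _ (fun t => z t + defect (target z) t *: f)
    (fun x => A *m x)); first exact: base_continuous.
  exact: A_continuous.
apply: (@continuous_comp _ _ _ (curve z) Q); last exact: Q_continuous.
have -> : curve z = (fun t => (z t + defect (target z) t *: f) + X (target z) t).
  by apply/funext => s; rewrite /curve addrAC.
apply: cvgD; first exact: base_continuous.
exact: is_derive_continuous (steering_curve st _ t).
Qed.

Let defectZ_le z t : bounded_curve rho z -> t \in `[0, T] ->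
  `|defect (target z) t *: f| <= D.
Proof.
move=> zB tT; rewrite normrZ ler_wpM2r//.
by apply: defect_le => //; exact: target_le.
Qed.

Let curve_bound z t : bounded_curve rho z -> t \in `[0, T] ->
  `|curve z t| <= rho + C * (2 * rho) + D.
Proof.
move=> zB tT; apply: le_trans (ler_normD _ _) _.
apply: lerD; last exact: defectZ_le.
apply: le_trans (ler_normD _ _) _; apply: lerD; first exact: zB.2.
apply: le_trans (curve_le _ tT) _; rewrite ler_wpM2l//; exact: target_le.
Qed.

Let speed_bound z t : bounded_curve rho z -> t \in `[0, T] ->
  `|speed z t| <= l * (rho + D) + k * r * (rho + C * (2 * rho) + D).
Proof.
move=> zB tT; apply: le_trans (ler_normD _ _) _; apply: lerD.
  apply: le_trans (Al _) _; rewrite ler_wpM2l//.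
  apply: le_trans (ler_normD _ _) _; apply: lerD; first exact: zB.2.
  exact: defectZ_le.
have cb := curve_bound zB tT.
have := @Qlip r (curve z t) 0; rewrite Q0 !subr0 normr0 => /(_ _ (ltW r0)).
move=> H; apply: le_trans (H _) _; first exact: le_trans small_r.
by rewrite ler_wpM2l// mulr_ge0// ltW.
Qed.

Let speed_lip z z' e t : bounded_curve rho z -> bounded_curve rho z' ->
  (forall t, `|z t - z' t| <= e) -> t \in `[0, T] ->
  `|speed z t - speed z' t| <= (2 * l + k * r * (2 + C)) * e.
Proof.
move=> zB z'B zz' tT.
have e0 : 0 <= e by exact: le_trans (zz' 0).
have tt' : `|target z - target z'| <= e.
  by rewrite /target opprB addrC subrKA distrC.
have dd : `|defect (target z) t *: f - defect (target z') t *: f| <= e.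
  rewrite -scalerBl normrZ.
  have := defect_lip (target_le zB) (target_le z'B) tt' tT.
  move=> /(ler_wpM2r (normr_ge0 f)) /le_trans; apply.
  have -> : C * e * h * `|f| = (C * h * `|f|) * e by ring.
  by rewrite -[leRHS]mul1r ler_wpM2r.
have base : `|(z t + defect (target z) t *: f) -
              (z' t + defect (target z') t *: f)| <= 2 * e.
  rewrite opprD addrACA; apply: le_trans (ler_normD _ _) _.
  by have := zz' t; lra.
have -> : (2 * l + k * r * (2 + C)) * e =
  l * (2 * e) + k * r * (2 * e + C * e) by ring.
rewrite /speed opprD addrACA; apply: le_trans (ler_normD _ _) _; apply: lerD.
  by rewrite -mulmxBr; apply: le_trans (Al _) _; rewrite ler_wpM2l.
apply: le_trans (@Qlip r _ _ _ _) _.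
- exact: le_trans (curve_bound zB tT) small_r.
- exact: le_trans (curve_bound z'B tT) small_r.
rewrite ler_wpM2l//; first by rewrite mulr_ge0// ltW.
have -> : curve z t - curve z' t =
    ((z t + defect (target z) t *: f) - (z' t + defect (target z') t *: f)) +
    (X (target z) t - X (target z') t).
  by rewrite /curve [z t + _ + _]addrAC [z' t + _ + _]addrAC opprD addrACA.
apply: le_trans (ler_normD _ _) _; apply: lerD => //.
apply: le_trans (steering_curve_le st _ _ tT) _.
exact: ler_wpM2l.
Qed.

Let m1_lt t : t \in `[0, T] -> -1 < t.
Proof. by rewrite in_itv/= => /andP[? _]; lra. Qed.

Let sub_clamp s t : s \in `[0, clamp t] -> s \in `[0, T].
Proof.
have := clampI t; rewrite !in_itv/= => /andP[_ h1] /andP[-> h2]/=.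
exact: le_trans h1.
Qed.

Let clamp_ge0 t : 0 <= clamp t.
Proof. by have := clampI t; rewrite in_itv/= => /andP[]. Qed.

Let clamp_leT t : clamp t <= T.
Proof. by have := clampI t; rewrite in_itv/= => /andP[]. Qed.

Let step_bounded z : bounded_curve rho z -> bounded_curve rho (step z).
Proof.
move=> zB; have [P0 dP] := primitive_ofP (speed_continuous zB).
split=> t; last first.
  have M0 : 0 <= l * (rho + D) + k * r * (rho + C * (2 * rho) + D).
    exact: le_trans (speed_bound zB (clampI t)).
  have := @mean_value_le _ _ (primitive_of (speed z)) (speed z) _ 0 (clamp t)
    (clamp_ge0 t) M0.
  rewrite P0 !subr0 => H; apply: le_trans (H _ _) _.
  + by move=> s /sub_clamp/m1_lt; exact: dP.
  + by move=> s /sub_clamp; exact: speed_bound.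
  + by apply: le_trans small_self; rewrite mulrC ler_wpM2r.
apply: (@continuous_comp _ _ _ clamp (primitive_of (speed z))).
  apply: (@lipschitz_continuous _ _ _ _ _ 1 1) => // s _; rewrite mul1r.
  by apply: max_lipschitz; [rewrite subrr normr0|apply: min_lipschitz;
    rewrite // subrr normr0].
by apply: is_derive_continuous (dP _ _); exact/m1_lt.
Qed.

Let step_contract z z' e : bounded_curve rho z -> bounded_curve rho z' ->
  (forall t, `|z t - z' t| <= e) -> forall t, `|step z t - step z' t| <= e / 2.
Proof.
move=> zB z'B zz' t.
have e0 : 0 <= e by exact: le_trans (zz' 0).
have [P0 dP] := primitive_ofP (speed_continuous zB).
have [P'0 dP'] := primitive_ofP (speed_continuous z'B).
have M0 : 0 <= (2 * l + k * r * (2 + C)) * e.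
  exact: le_trans (speed_lip zB z'B zz' (clampI t)).
have := @mean_value_le _ _ (fun s => primitive_of (speed z) s -
    primitive_of (speed z') s) (fun s => speed z s - speed z' s) _ 0 (clamp t)
    (clamp_ge0 t) M0.
rewrite P0 P'0 !subr0 => H; apply: le_trans (H _ _) _.
- move=> s /sub_clamp/m1_lt s1; have d1 := dP _ s1; have d2 := dP' _ s1.
  exact: is_deriveB.
- by move=> s /sub_clamp; exact: speed_lip.
- apply: (@le_trans _ _ ((2 * l + k * r * (2 + C)) * e * T)).
    by rewrite ler_wpM2l.
  by have := ler_wpM2r e0 small_T; lra.
Qed.

(** The trajectory is [curve z] at the fixed point [z]: the control of the
sawtooth replaces [v p], and the sawtooth meets [w p] at both ends, so the
endpoint is [z T + (q - z T)]. *)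
Lemma steering_correction (U : set R) : U a -> U b ->
  reachable (fun x => A *m x + Q x) f U T 0 q.
Proof.
move=> Ua Ub.
have [z zB zfix] := sup_contraction_fixpoint (ltW rho0) step_bounded step_contract.
have [P0 dP] := primitive_ofP (speed_continuous zB).
set p := target z.
have zP t : t \in `[0, T] -> primitive_of (speed z) t = z t.
  by move=> tT; rewrite -zfix /step clamp_id.
have [u [uab iu du]] := sawtooth_control ab h0 N0 (w_slope (target_le zB)).
have TT : T \in `[0, T] by rewrite in_itv/= lexx ltW.
exists u, (fun t => primitive_of (speed z) t + X p t + defect p t *: f); split.
- split; first by rewrite TN.
  by move=> t _; have [->|->] := uab t.
- split.
    apply: acD; first apply: acD.
    + apply: (@ac_lipschitz _ _ _ _ _
        (l * (rho + D) + k * r * (rho + C * (2 * rho) + D))).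
      move=> s t sT tT s_t.
      have sub x := @sub_segment R T s t x sT tT.
      apply: mean_value_le => //.
      * exact: le_trans (speed_bound zB sT).
      * by move=> x /sub/m1_lt; exact: dP.
      * by move=> x /sub; exact: speed_bound.
    + apply: (@ac_lipschitz _ _ _ _ _ (l * (C * `|p|) + C * `|p| * `|f|)).
      move=> s t sT tT s_t.
      have sub x := @sub_segment R T s t x sT tT.
      apply: (@mean_value_le _ _ (X p) (fun t => A *m X p t + v p t *: f)) => //.
      * by rewrite addr_ge0// !mulr_ge0.
      * by move=> x _; exact: steering_curve st p x.
      * move=> x /sub xT; apply: le_trans (ler_normD _ _) _; apply: lerD.
          by apply: le_trans (Al _) _; rewrite ler_wpM2l// curve_le.
        by rewrite normrZ ler_wpM2r// control_le.
    + apply: (@ac_lipschitz _ _ _ _ _ ((`|a| + `|b| + C * `|p|) * `|f|)).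
      move=> s t sT tT s_t; rewrite -scalerBl normrZ mulrAC ler_wpM2r//.
      have -> : defect p t - defect p s =
        (saw p t - saw p s) - (w p t - w p s) by rewrite /defect; ring.
      apply: le_trans (ler_normB _ _) _; rewrite mulrDl lerD//.
        exact: sawtooth_lipschitz.
      have sub x := @sub_segment R T s t x sT tT.
      rewrite ler_norml -mulNr.
      apply: (@le_MVT _ (w p) (v p)) => // [x|x /sub xT].
        exact: steering_primitive st p x.
      by rewrite -ler_norml control_le.
  move: du; apply: filterS; first exact: (ae_filter_ringOfSetsType lebesgue_measure).
  move=> t dsaw tT; have {}dsaw : is_derive t 1 (saw p) (u t).
    by apply: dsaw; rewrite -TN.
  have d1 := dP t (m1_lt tT); have d2 := steering_curve st p t.
  have d3 := steering_primitive st p t.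
  have d4 : is_derive t 1 (defect p) (u t - v p t) by exact: is_deriveB.
  have d5 : is_derive t 1 (fun t => defect p t *: f) ((u t - v p t) *: f).
    exact: is_deriveZr.
  apply: is_derive_eq; rewrite zP// /speed -/p -/(curve z t).
  have -> : A *m curve z t = A *m (z t + defect p t *: f) + A *m X p t.
    by rewrite -mulmxDr addrAC.
  rewrite [(u t - v p t) *: f]scalerBl -[LHS]addrA [X in _ + X = _]addrACA subrr addr0 addrA.
  by rewrite [X in X + _ = _]addrAC.
- rewrite P0 (steering_start st) /defect /saw sawtooth0//.
    by rewrite subrr scale0r !addr0.
  exact: w_slope (target_le zB).
- rewrite zP// (steering_end st) /defect /saw TN sawtoothT//.
    by rewrite subrr scale0r addr0 -TN /p /target addrC subrK.
  exact: w_slope (target_le zB).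
Qed.

End correction.

(** * The linear test *)

Lemma mulmx_norm_le (R : realType) (n : nat) (A : 'M[R]_n) (x : 'cV[R]_n) :
  `|A *m x| <= n%:R * `|A| * `|x|.
Proof.
apply: mx_norm_leP => [|i j]; first by rewrite !mulr_ge0.
rewrite mxE; apply: le_trans (ler_norm_sum _ _ _) _.
rewrite -mulrA -[n in n%:R](card_ord n) mulr_natl -sumr_const.
by apply: ler_sum => s _; rewrite normrM ler_pM// ler_coord_norm.
Qed.

(** A linear family is a finite combination of the curves of a basis, each of
which is bounded on the compact time interval. *)
Lemma linear_family_bound (R : realType) (n : nat) (W : normedModType R)
    (X : 'cV[R]_n -> R -> W) (T : R) : 0 <= T ->
  (forall t, linear (X ^~ t)) -> (forall p, continuous (X p)) ->
  exists2 C : R, 0 <= C & forall p p' t, t \in `[0, T] ->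
    `|X p t - X p' t| <= C * `|p - p'|.
Proof.
move=> T0 linX cX.
have bnd i : exists M : R, forall t, t \in `[0, T] -> `|X (delta_mx i 0) t| <= M.
  have [|c _ cP] := @EVT_max R (fun t => `|X (delta_mx i 0) t|) 0 T T0.
    by apply: continuous_subspaceT => t; apply: cvg_norm; exact: cX.
  by exists `|X (delta_mx i 0) c|.
pose M i := sval (cid (bnd i)).
have MP i t : t \in `[0, T] -> `|X (delta_mx i 0) t| <= M i.
  by rewrite /M; case: cid => /= y; apply.
have M0 i : 0 <= M i.
  by apply: le_trans (MP i 0 _); rewrite ?in_itv/= ?lexx.
exists (\sum_i M i) => [|p p' t tT]; first exact: sumr_ge0.
pose L : {linear 'cV[R]_n -> W} :=
  HB.pack (X ^~ t) (GRing.isLinear.Build _ _ _ _ (X ^~ t) (linX t)).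
rewrite -[X p t]/(L p) -[X p' t]/(L p') -linearB.
rewrite {1}[p - p']matrix_sum_delta.
under eq_bigr do rewrite big_ord1.
rewrite linear_sum mulr_suml; apply: le_trans (ler_norm_sum _ _ _) _.
apply: ler_sum => i _; rewrite linearZ normrZ mulrC ler_pM//.
  exact: MP.
exact: ler_coord_norm.
Qed.

(** The linear test for small-time local controllability with controls limited
to two values of opposite signs. The constants are chosen in the order [T] (so
that the linear part contracts), [r] (so that the quadratic part contracts
although [C] blows up as [T] shrinks), [rho] (so that the controls stay between
[a] and [b]), and the cell length [h] of the sawtooth. *)
Lemma linear_test (R : realType) (n : nat) (A : 'M[R]_n)
    (Q : 'cV[R]_n -> 'cV[R]_n) (f : 'cV[R]_n) (k a b : R) (U : set R) :
  0 <= k -> Q 0 = 0 ->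
  (forall s x y, `|x| <= s -> `|y| <= s -> `|Q x - Q y| <= k * s * `|x - y|) ->
  (forall T : R, 0 < T -> exists2 C : R, 0 <= C &
    exists X v w, linear_steering A f T C X v w) ->
  a < 0 -> 0 < b -> U a -> U b ->
  stlc (fun x => A *m x + Q x) f U 0.
Proof.
move=> k0 Q0 Qlip steer a0 b0 Ua Ub T0 T0_gt0.
pose l := n%:R * `|A|; have l0 : 0 <= l by rewrite mulr_ge0.
pose T := Num.min T0 (8 * (l + 1))^-1.
have T_gt0 : 0 < T by rewrite lt_min T0_gt0 invr_gt0; lra.
have TT0 : T <= T0 by rewrite ge_min lexx.
have Tl : T * l <= 1 / 8.
  have : T * (8 * (l + 1)) <= 1.
    by rewrite -ler_pdivlMr ?div1r ?ge_min ?lexx ?orbT//; lra.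
  lra.
have [C C0 [X [v [w st]]]] := steer T T_gt0.
pose r := (8 * (T * (k + 1) * (2 + 2 * C)))^-1.
have r_den : 0 < 8 * (T * (k + 1) * (2 + 2 * C)).
  by rewrite !mulr_gt0//; lra.
have r_gt0 : 0 < r by rewrite invr_gt0.
have Tkr : T * k * r * (2 + 2 * C) <= 1 / 8.
  have e1 : T * (k + 1) * (2 + 2 * C) * r = 1 / 8.
    have : 8 * (T * (k + 1) * (2 + 2 * C)) * r = 1 by rewrite divff// gt_eqF.
    lra.
  have e2 : 0 <= T * r * (2 + 2 * C) by rewrite !mulr_ge0 ?(ltW T_gt0) ?(ltW r_gt0)//; lra.
  lra.
pose m := Num.min (- a) b.
have m0 : 0 < m by rewrite lt_min oppr_gt0 a0.
have ma : m <= - a by rewrite ge_min lexx.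
have mb : m <= b by rewrite ge_min lexx orbT.
have C1 : 0 < 1 + 2 * C by lra.
pose rho := Num.min (r / 2 / (1 + 2 * C)) (m / (1 + 2 * C)).
have rho_gt0 : 0 < rho by rewrite lt_min !divr_gt0.
have rho_r : rho * (1 + 2 * C) <= r / 2.
  by rewrite -ler_pdivlMr// ge_min lexx.
have rho_m : rho * (1 + 2 * C) <= m.
  by rewrite -ler_pdivlMr// ge_min lexx orbT.
pose d := Num.min rho (r / 2).
have d0 : 0 < d by rewrite lt_min rho_gt0 divr_gt0.
have d_rho : d <= rho by rewrite ge_min lexx.
have d_r : d <= r / 2 by rewrite ge_min lexx orbT.
have f0 : 0 <= `|f| by [].
have CF : 0 < C * `|f| + 1 by rewrite ltr_wpDl// mulr_ge0.
have ab : 0 <= b - a by lra.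
have DF : 0 < (b - a) * `|f| + 1 by rewrite ltr_wpDl// mulr_ge0.
pose h0 := Num.min (C * `|f| + 1)^-1 (d / ((b - a) * `|f| + 1)).
have h0_gt0 : 0 < h0 by rewrite lt_min invr_gt0 CF divr_gt0.
pose N := (Num.bound (T / h0)).+1.
have N_gt0 : 0 < N%:R :> R by rewrite ltr0n.
pose h := T / N%:R.
have h_gt0 : 0 < h by rewrite divr_gt0.
have TN : T = N%:R * h by rewrite /h mulrCA divff ?mulr1// gt_eqF.
have hh0 : h <= h0.
  rewrite /h ler_pdivrMr// mulrC -ler_pdivrMr//.
  apply: ltW; apply: lt_trans (archi_boundP _) _; last by rewrite ltr_nat.
  by rewrite divr_ge0// ltW.
have hC : h * (C * `|f| + 1) <= 1.
  rewrite -ler_pdivlMr// div1r; apply: le_trans hh0 _.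
  by rewrite ge_min lexx.
have hD : h * ((b - a) * `|f| + 1) <= d.
  rewrite -ler_pdivlMr//; apply: le_trans hh0 _.
  by rewrite ge_min lexx orbT.
have hD' : (b - a) * h * `|f| <= d by lra.
have D0 : 0 <= (b - a) * h * `|f| by rewrite !mulr_ge0// ltW.
have Tkr0 : 0 <= T * k * r by rewrite !mulr_ge0// ltW.
have Tl0 : 0 <= T * l by rewrite mulr_ge0// ltW.
have Tkr2 : 0 <= T * k * r * C by rewrite mulr_ge0.
apply/nbhs_ballP; exists rho => // q.
rewrite -ball_normE/= sub0r normrN => /ltW q_le.
exists T; first by rewrite /= in_itv/= TT0 ltW.
apply: (@steering_correction R n A Q f l k r rho T C a b h N X v w q) => //.
- exact: mulmx_norm_le.
- lra.
- lra.
- lra.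
- lra.
- lra.
- set D := (b - a) * h * `|f| in D0 hD' *.
  have e1 : T * l * (rho + D) <= 1 / 8 * (2 * rho).
    by apply: ler_pM => //; lra.
  have e2 : T * k * r * (rho + C * (2 * rho) + D) <=
            T * k * r * (2 + 2 * C) * rho.
    rewrite -[leRHS]mulrA; apply: ler_wpM2l => //; lra.
  have e3 : T * k * r * (2 + 2 * C) * rho <= 1 / 8 * rho.
    by rewrite ler_wpM2r// ltW.
  lra.
Qed.

(** * Steering of the linearised Sprott system *)

Lemma ordS0 : ordS i0 = i1. Proof. exact: val_inj. Qed.
Lemma ordS1 : ordS i1 = i2. Proof. exact: val_inj. Qed.
Lemma ordS2 : ordS i2 = i0. Proof. exact: val_inj. Qed.

(** The linear part of the drift is [- mu - P], where [P] is a cyclic shift of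
the coordinates and [P2] its square. In the basis [f], [P f], [P^2 f] the
system is a chain driven by [v] whose last coordinate is free: every function
vanishing to third order at 0 arises, and the other two coordinates and the
control are combinations of its derivatives. *)
Section sprott_steering.
Context {R : realType}.
Variables (mu : R) (f : 'cV[R]_3) (T : R).

Let f0 := f i0 0.
Let f1 := f i1 0.
Let f2 := f i2 0.

(** Determinant of the matrix with columns [f], [P f], [P^2 f]; it is the
product of the coordinate sum and half the sum of the squared coordinate
differences. *)
Definition circulant_det : R :=
  f0 ^+ 3 + f1 ^+ 3 + f2 ^+ 3 - 3 * (f0 * f1 * f2).

Hypothesis det_neq0 : circulant_det != 0.
Hypothesis T_gt0 : 0 < T.

Implicit Types p : 'cV[R]_3.

(** Coordinates of [p] in the basis [f], [P f], [P^2 f], by Cramer's rule. *)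
Let c0 p : R := ((f0 ^+ 2 - f1 * f2) * p i0 0 + (f1 ^+ 2 - f0 * f2) * p i1 0 +
  (f2 ^+ 2 - f0 * f1) * p i2 0) / circulant_det.
Let c1 p : R := ((f2 ^+ 2 - f0 * f1) * p i0 0 + (f0 ^+ 2 - f1 * f2) * p i1 0 +
  (f1 ^+ 2 - f0 * f2) * p i2 0) / circulant_det.
Let c2 p : R := ((f1 ^+ 2 - f0 * f2) * p i0 0 + (f2 ^+ 2 - f0 * f1) * p i1 0 +
  (f0 ^+ 2 - f1 * f2) * p i2 0) / circulant_det.

Let circulantK p : c0 p *: f + c1 p *: P2 (P2 f) + c2 p *: P2 f = p.
Proof.
apply/colP; apply: forall3; rewrite !mxE !(ordS0, ordS1, ordS2) -/f0 -/f1 -/f2;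
  by rewrite /c0 /c1 /c2; move: det_neq0; rewrite /circulant_det => H; field.
Qed.

(** The values that [flat0], [flat1], [flat2] must take at time [T] for the
curve to end at [p]. *)
Let g0 p : R := c2 p.
Let g1 p : R := - c1 p - mu * c2 p.
Let g2 p : R := c0 p + 2 * mu * c1 p + mu ^+ 2 * c2 p.

(** Hermite interpolation: [flat0] is the quintic that vanishes to third order
at 0 and has the prescribed value and two derivatives at [T]. *)
Let x4 p : R := 5 / 2 * g0 p / T ^+ 3 - g1 p / T ^+ 2 + g2 p / (8 * T).
Let x5 p : R :=
  - 3 * g0 p / T ^+ 4 + 7 / 5 * g1 p / T ^+ 3 - g2 p / (5 * T ^+ 2).
Let x6 p : R := g0 p / T ^+ 5 - 1 / 2 * g1 p / T ^+ 4 + g2 p / (12 * T ^+ 3).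

(** [int_flat] is a primitive of the last coordinate [flat0], and [flat1],
[flat2], [flat3] are its derivatives; the primitive of the control needs
[int_flat]. *)
Let int_flat p (t : R) : R := x4 p * t ^+ 4 + x5 p * t ^+ 5 + x6 p * t ^+ 6.
Let flat0 p (t : R) : R :=
  4 * x4 p * t ^+ 3 + 5 * x5 p * t ^+ 4 + 6 * x6 p * t ^+ 5.
Let flat1 p (t : R) : R :=
  12 * x4 p * t ^+ 2 + 20 * x5 p * t ^+ 3 + 30 * x6 p * t ^+ 4.
Let flat2 p (t : R) : R :=
  24 * x4 p * t + 60 * x5 p * t ^+ 2 + 120 * x6 p * t ^+ 3.
Let flat3 p (t : R) : R :=
  24 * x4 p + 120 * x5 p * t + 360 * x6 p * t ^+ 2.

Let d_int_flat p (t : R) : is_derive t 1 (int_flat p) (flat0 p t).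
Proof. by apply: is_derive_eq; rewrite /flat0 /GRing.scale/=; ring. Qed.

Let d_flat0 p (t : R) : is_derive t 1 (flat0 p) (flat1 p t).
Proof. by apply: is_derive_eq; rewrite /flat1 /GRing.scale/=; ring. Qed.

Let d_flat1 p (t : R) : is_derive t 1 (flat1 p) (flat2 p t).
Proof. by apply: is_derive_eq; rewrite /flat2 /GRing.scale/=; ring. Qed.

Let d_flat2 p (t : R) : is_derive t 1 (flat2 p) (flat3 p t).
Proof. by apply: is_derive_eq; rewrite /flat3 /GRing.scale/=; ring. Qed.

Let flat0_end p : flat0 p T = g0 p.
Proof. by have := gt_eqF T_gt0; rewrite /flat0 /x4 /x5 /x6 => /negbT H; field. Qed.

Let flat1_end p : flat1 p T = g1 p.
Proof. by have := gt_eqF T_gt0; rewrite /flat1 /x4 /x5 /x6 => /negbT H; field. Qed.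

Let flat2_end p : flat2 p T = g2 p.
Proof. by have := gt_eqF T_gt0; rewrite /flat2 /x4 /x5 /x6 => /negbT H; field. Qed.

Let al p t := flat2 p t + 2 * mu * flat1 p t + mu ^+ 2 * flat0 p t.
Let be p t := - flat1 p t - mu * flat0 p t.

Let X p t : 'cV[R]_3 := al p t *: f + be p t *: P2 (P2 f) + flat0 p t *: P2 f.
Let v p t : R := flat3 p t + 3 * mu * flat2 p t + 3 * mu ^+ 2 * flat1 p t +
  (mu ^+ 3 + 1) * flat0 p t.
Let w p t : R := flat2 p t + 3 * mu * flat1 p t + 3 * mu ^+ 2 * flat0 p t +
  (mu ^+ 3 + 1) * int_flat p t.

Let dw p (t : R) : is_derive t 1 (w p) (v p t).
Proof.
have d0 := d_int_flat p t; have d1 := d_flat0 p t; have d2 := d_flat1 p t.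
have d3 := d_flat2 p t.
by apply: is_derive_eq; rewrite /v /GRing.scale/=; ring.
Qed.

Let dX p (t : R) : is_derive t 1 (X p) (sprott_mx mu *m X p t + v p t *: f).
Proof.
have d1 := d_flat0 p t; have d2 := d_flat1 p t; have d3 := d_flat2 p t.
have dal : is_derive t 1 (al p)
    (flat3 p t + 2 * mu * flat2 p t + mu ^+ 2 * flat1 p t).
  by apply: is_derive_eq; rewrite /GRing.scale/=; ring.
have dbe : is_derive t 1 (be p) (- flat2 p t - mu * flat1 p t).
  by apply: is_derive_eq; rewrite /GRing.scale/=; ring.
have e1 := is_deriveZr f dal; have e2 := is_deriveZr (P2 (P2 f)) dbe.
have e3 := is_deriveZr (P2 f) d1.
have := is_deriveD (is_deriveD e1 e2) e3.
set dx := (X in is_derive _ _ _ X -> _) => H.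
suff <- : dx = sprott_mx mu *m X p t + v p t *: f by [].
by apply/colP; apply: forall3; rewrite /dx !mxE sum3 !mxE /=
  !(ordS0, ordS1, ordS2) -/f0 -/f1 -/f2 /v /al /be; ring.
Qed.

Let lin_x4 c p p' : x4 (c *: p + p') = c * x4 p + x4 p'.
Proof. by rewrite /x4 /g0 /g1 /g2 /c0 /c1 /c2 !mxE; ring. Qed.
Let lin_x5 c p p' : x5 (c *: p + p') = c * x5 p + x5 p'.
Proof. by rewrite /x5 /g0 /g1 /g2 /c0 /c1 /c2 !mxE; ring. Qed.
Let lin_x6 c p p' : x6 (c *: p + p') = c * x6 p + x6 p'.
Proof. by rewrite /x6 /g0 /g1 /g2 /c0 /c1 /c2 !mxE; ring. Qed.

Let linX t : linear (X ^~ t).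
Proof.
move=> c p p'; apply/colP => i; rewrite !mxE /al /be /flat2 /flat1 /flat0.
by rewrite lin_x4 lin_x5 lin_x6; ring.
Qed.

Let linv t : linear (v ^~ t).
Proof.
move=> c p p'; rewrite /v /flat3 /flat2 /flat1 /flat0 /GRing.scale/=.
by rewrite lin_x4 lin_x5 lin_x6; ring.
Qed.

Lemma sprott_linear_steering : exists2 C : R, 0 <= C &
  exists X v w, linear_steering (sprott_mx mu) f T C X v w.
Proof.
have cX p : continuous (X p) by move=> t; exact: is_derive_continuous (dX p t).
have cv p : continuous (v p).
  move=> t; rewrite /v /flat3 /flat2 /flat1 /flat0.
  have : derivable (v p) t 1 by apply: ex_derive.
  by move=> H; apply: differentiable_continuous; apply/derivable1_diffP.
have [CX CX0 XC] := linear_family_bound (ltW T_gt0) linX cX.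
have [Cv Cv0 vC] := linear_family_bound (ltW T_gt0) linv cv.
exists (CX + Cv); first exact: addr_ge0.
exists X, v, w; split => //.
- move=> p; have z0 : flat0 p 0 = 0 by rewrite /flat0; ring.
  have z1 : flat1 p 0 = 0 by rewrite /flat1; ring.
  have z2 : flat2 p 0 = 0 by rewrite /flat2; ring.
  by rewrite /X /al /be z0 z1 z2 !mulr0 oppr0 !addr0 !scale0r !addr0.
- move=> p; rewrite -[RHS]circulantK /X /al /be flat0_end flat1_end flat2_end.
  by congr (_ *: _ + _ *: _ + _ *: _); rewrite /g2 /g1 /g0; ring.
- move=> p p' t tT; apply: le_trans (XC p p' t tT) _.
  by rewrite ler_wpM2r// lerDl.
- move=> p p' t tT; apply: le_trans (vC p p' t tT) _.
  by rewrite ler_wpM2r// lerDr.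
- by move=> t; have := linX t (-1) 0 0; rewrite scaler0 addr0 scaleN1r addNr.
- by move=> t; have := linv t (-1) 0 0; rewrite scaler0 addr0 scaleN1r addNr.
Qed.

End sprott_steering.

(** * Sufficiency for the Sprott system *)

(** The two factors of the determinant vanish exactly when [f] is orthogonal to
[ones] and when [f] is a multiple of [ones]. *)
Lemma circulant_det_neq0 (R : realType) (f : 'cV[R]_3) :
  ~ (span_ones `|` orthogonal_complement span_ones) f -> circulant_det f != 0.
Proof.
move=> nf; apply/eqP.
set f0 := f i0 0; set f1 := f i1 0; set f2 := f i2 0.
rewrite /circulant_det -/f0 -/f1 -/f2 => det0.
have : (f0 + f1 + f2) *
  ((f0 - f1) ^+ 2 + (f1 - f2) ^+ 2 + (f2 - f0) ^+ 2) = 0.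
  by transitivity (2 * (f0 ^+ 3 + f1 ^+ 3 + f2 ^+ 3 - 3 * (f0 * f1 * f2)));
    [ring|rewrite det0 mulr0].
move/eqP; rewrite mulf_eq0 => /orP[/eqP s0|/eqP e0]; apply: nf.
  right=> x /= /vlineP[c ->].
  by rewrite /dotv sum3 !mxE -/f0 -/f1 -/f2 -[RHS](mulr0 c) -s0; ring.
left; apply/vlineP; exists f0; apply/colP.
have h1 := sqr_ge0 (f0 - f1); have h2 := sqr_ge0 (f1 - f2).
have h3 := sqr_ge0 (f2 - f0).
have : (f0 - f1) ^+ 2 = 0 by lra.
have : (f2 - f0) ^+ 2 = 0 by lra.
move=> /eqP; rewrite sqrf_eq0 subr_eq0 => /eqP e2.
move=> /eqP; rewrite sqrf_eq0 subr_eq0 => /eqP e1.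
by apply: forall3; rewrite !mxE mulr1.
Qed.

Definition sprott_quad (R : realType) (x : 'cV[R]_3) : 'cV[R]_3 :=
  hadamard (P2 x) (P2 x).

Lemma sprott_quad_lip (R : realType) (s : R) (x y : 'cV[R]_3) :
  `|x| <= s -> `|y| <= s ->
  `|sprott_quad x - sprott_quad y| <= 2 * s * `|x - y|.
Proof.
move=> xs ys; have s0 : 0 <= s by exact: le_trans xs.
apply: mx_norm_leP => [|i j]; first by rewrite !mulr_ge0.
rewrite !mxE.
have -> : x (ordS i) 0 * x (ordS i) 0 - y (ordS i) 0 * y (ordS i) 0 =
  (x (ordS i) 0 + y (ordS i) 0) * (x - y) (ordS i) 0 by rewrite !mxE; ring.
rewrite normrM ler_pM// ?ler_coord_norm//.
apply: le_trans (ler_normD _ _) _.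
have := ler_coord_norm x (ordS i) 0; have := ler_coord_norm y (ordS i) 0; lra.
Qed.

Lemma sprott_quad0 (R : realType) : sprott_quad (0 : 'cV[R]_3) = 0.
Proof. by apply/colP => i; rewrite !mxE mulr0. Qed.

Lemma convex_hull_gt0 (R : realType) (U : set R) (x : R) :
  convex_hull U x -> 0 < x -> exists2 b, 0 < b & U b.
Proof.
move=> [n [c [v [c0 Uv _ ->]]]] x0.
have [[i vi]|/forallNP nv] := pselect (exists i, 0 < v i); first by exists (v i).
suff : \sum_i c i * v i <= 0 by rewrite leNgt x0.
by apply: sumr_le0 => i _; rewrite mulr_ge0_le0// leNgt; apply/negP.
Qed.

Lemma convex_hull_lt0 (R : realType) (U : set R) (x : R) :
  convex_hull U x -> x < 0 -> exists2 a, a < 0 & U a.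
Proof.
move=> [n [c [v [c0 Uv _ ->]]]] x0.
have [[i vi]|/forallNP nv] := pselect (exists i, v i < 0); first by exists (v i).
suff : 0 <= \sum_i c i * v i by rewrite leNgt x0.
by apply: sumr_ge0 => i _; rewrite mulr_ge0// leNgt; apply/negP.
Qed.

Theorem proposition4p1 (R : realType) (mu : R) (f : 'cV[R]_3) (U : set R)
    (f_neq0 : f != 0)
    (U_bounded : bounded_set U)
    (U_affine : affine_hull U = setT)
    (U_convex : (convex_hull U)° 0) :
  stlc (sprott_drift mu) f U 0 <->
  ~ (span_ones `|` orthogonal_complement span_ones) f.
Proof.
split=> [|/circulant_det_neq0 det0]; first exact: stlc_necessary.
have [r r0 hr] := nbhs0_scale (1 : R) U_convex.
have [s s0 hs] := nbhs0_scale (-1 : R) U_convex.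
have [b b0 Ub] : exists2 b, 0 < b & U b.
  by apply: convex_hull_gt0 hr _; rewrite /GRing.scale/= mulr1.
have [a a0 Ua] : exists2 a, a < 0 & U a.
  by apply: convex_hull_lt0 hs _; rewrite /GRing.scale/= mulrN1 oppr_lt0.
apply: (@linear_test R 3 (sprott_mx mu) (@sprott_quad R) f 2 a b U) => //.
- exact: sprott_quad0.
- exact: sprott_quad_lip.
- by move=> T T0; exact: sprott_linear_steering.
Qed.
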